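(* There exists an $O(n^8)$-time algorithm whose input is a trigraph $T$ on $n$ vertices, with the following output: a small homogeneous pair of $T$ if one exists; otherwise, if $T$ has a homogeneous cut, a minimally-sided homogeneous cut of $T$; otherwise the statement ``$T$ has no small homogeneous pair, no proper homogeneous pair and no homogeneous set''.
   Context: A trigraph $T$ consists of a finite vertex set $V(T)$ and a map $\theta:\binom{V(T)}{2}\to\{-1,0,1\}$. Distinct $u,v$ are strongly adjacent if $\theta(uv)=1$, strongly antiadjacent if $\theta(uv)=-1$, semiadjacent (a switchable pair) if $\theta(uv)=0$. A vertex $b\notin A$ is strongly complete (strongly anticomplete) to $A$ if it is strongly adjacent (strongly antiadjacent) to all of $A$; a set is strongly complete/anticomplete to $A$ if all its vertices are. A homogeneous set is a set $X$ with $1<|X|<|V(T)|$ such that every vertex outside $X$ is strongly complete or strongly anticomplete to $X$. A homogeneous pair is a pair $(A,B)$ of disjoint nonempty sets for which there exist disjoint (possibly empty) $C,D,E,F$ with union $V(T)\setminus(A\cup B)$ (a split) such that $A$ is strongly complete to $C\cup E$ and strongly anticomplete to $D\cup F$, $B$ is strongly complete to $D\cup E$ and strongly anticomplete to $C\cup F$, $A$ is neither strongly complete nor strongly anticomplete to $B$, $|A\cup B|\ge3$ and $|C\cup D\cup E\cup F|\ge3$. It is small if $|A\cup B|\le6$ and proper if $C\ne\emptyset$ and $D\ne\emptyset$. A homogeneous cut is a partition $(X,Y)$ of $V(T)$ where $X$ is a homogeneous set or $X=A\cup B$ with $(A,B)$ a proper homogeneous pair; it is minimally-sided if there is no homogeneous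 cut $(X',Y')$ with $X'\subsetneq X$. *)

(* Defs.v *)
From mathcomp Require Import all_boot all_order all_algebra.
Set Implicit Arguments.
Unset Strict Implicit.
Unset Printing Implicit Defensive.

(** * Trigraphs *)

(* [theta] is only ever read on sets of cardinality 2, i.e. on unordered pairs
   of distinct vertices; its values on other sets are irrelevant. *)
Record trigraph (V : finType) := Trigraph {
  theta : {set V} -> int;
  thetaP : forall e : {set V}, #|e| = 2 -> theta e \in [:: (-1)%R; 0%R; 1%R]
}.

Section Trigraphs.
Variables (V : finType) (T : trigraph V).
Implicit Types (u v : V) (A B C D E F X Y : {set V}).

Definition strongly_adjacent u v := (u != v) && (theta T [set u; v] == 1%R).
Definition strongly_antiadjacent u v :=
  (u != v) && (theta T [set u; v] == (-1)%R).

Definition vertex_strongly_complete v A :=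
  (v \notin A) && [forall a in A, strongly_adjacent v a].
Definition vertex_strongly_anticomplete v A :=
  (v \notin A) && [forall a in A, strongly_antiadjacent v a].

Definition strongly_complete B A :=
  [forall b in B, vertex_strongly_complete b A].
Definition strongly_anticomplete B A :=
  [forall b in B, vertex_strongly_anticomplete b A].

Definition homogeneous_set X : Prop :=
  1 < #|X| < #|V| /\
  forall v, v \notin X ->
    vertex_strongly_complete v X \/ vertex_strongly_anticomplete v X.

Definition pairwise_disjoint4 C D E F :=
  [&& [disjoint C & D], [disjoint C & E], [disjoint C & F],
      [disjoint D & E], [disjoint D & F] & [disjoint E & F]].

(* (A, B) is a homogeneous pair with split (C, D, E, F). *)
Definition homogeneous_pair_split A B C D E F : Prop :=
  [/\ [/\ [disjoint A & B], A != set0 & B != set0],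
      pairwise_disjoint4 C D E F
        /\ C :|: D :|: E :|: F = ~: (A :|: B),
      [/\ strongly_complete A (C :|: E), strongly_anticomplete A (D :|: F),
          strongly_complete B (D :|: E) & strongly_anticomplete B (C :|: F)],
      ~~ strongly_complete A B /\ ~~ strongly_anticomplete A B &
      3 <= #|A :|: B| /\ 3 <= #|C :|: D :|: E :|: F|].

Definition homogeneous_pair A B : Prop :=
  exists C D E F, homogeneous_pair_split A B C D E F.

Definition small_homogeneous_pair A B : Prop :=
  homogeneous_pair A B /\ #|A :|: B| <= 6.

(* The split of a homogeneous pair is unique (A and B are nonempty), so
   quantifying over splits is harmless. *)
Definition proper_homogeneous_pair A B : Prop :=
  exists C D E F,
    [/\ homogeneous_pair_split A B C D E F, C != set0 & D != set0].

Definition homogeneous_cut X Y : Prop :=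
  [/\ X :|: Y = [set: V], [disjoint X & Y] &
      homogeneous_set X \/
      exists A B, X = A :|: B /\ proper_homogeneous_pair A B].

Definition minimally_sided_homogeneous_cut X Y : Prop :=
  homogeneous_cut X Y /\
  ~ exists X' Y', homogeneous_cut X' Y' /\ X' \proper X.

(** * Input-output specification *)

(* [OutNone] is the statement "T has no small homogeneous pair, no proper
   homogeneous pair and no homogeneous set". *)
Variant output :=
  | OutPair of {set V} & {set V}
  | OutCut of {set V} & {set V}
  | OutNone.

Definition has_small_homogeneous_pair : Prop :=
  exists A B, small_homogeneous_pair A B.
Definition has_proper_homogeneous_pair : Prop :=
  exists A B, proper_homogeneous_pair A B.
Definition has_homogeneous_set : Prop := exists X, homogeneous_set X.
Definition has_homogeneous_cut : Prop := exists X Y, homogeneous_cut X Y.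

Definition correct_output (o : output) : Prop :=
  [/\ has_small_homogeneous_pair ->
        exists A B, o = OutPair A B /\ small_homogeneous_pair A B,
      ~ has_small_homogeneous_pair -> has_homogeneous_cut ->
        exists X Y, o = OutCut X Y /\ minimally_sided_homogeneous_cut X Y &
      ~ has_small_homogeneous_pair -> ~ has_homogeneous_cut ->
        o = OutNone /\
        [/\ ~ has_small_homogeneous_pair, ~ has_proper_homogeneous_pair &
            ~ has_homogeneous_set]].

End Trigraphs.

(** * Model of computation: a word RAM

   Programs are while-programs over natural-number registers and a fixed number
   of arrays, with random read access to the input matrix.  Every evaluated
   expression node and every executed command costs one time unit.  All values
   must stay below the word bound [W]: a program computing a larger value is
   stuck and has no execution.  Taking W polynomial in n gives words of
   O(log n) bits, so unit cost is not exploitable through huge numbers. *)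

Variant binop := Add | Sub | Eq | Lt.

Inductive expr :=
  | Const of nat
  | Reg of nat
  | Read of nat & expr          (* array name, index *)
  | Input of expr & expr
  | Binop of binop & expr & expr.

Inductive prog :=
  | Skip
  | Assign of nat & expr
  | Write of nat & expr & expr  (* array name, index, value *)
  | Seq of prog & prog
  | If of expr & prog & prog    (* nonzero means true *)
  | While of expr & prog.

Record state := State { regs : nat -> nat; arrs : nat -> nat -> nat }.

Definition set_reg (s : state) (x v : nat) : state :=
  State (fun y => if y == x then v else regs s y) (arrs s).

Definition set_arr (s : state) (a i v : nat) : state :=
  State (regs s)
    (fun b j => if (b == a) && (j == i) then v else arrs s b j).

Definition eval_binop (op : binop) (v w : nat) : nat :=
  match op with
  | Add => v + w
  | Sub => v - w
  | Eq => v == w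
  | Lt => v < w
  end.

Section Semantics.
Variables (W : nat) (inp : nat -> nat -> nat).

Definition word (v : nat) : option nat := if v < W then Some v else None.

Fixpoint eval (s : state) (e : expr) : option nat :=
  match e with
  | Const k => word k
  | Reg x => word (regs s x)
  | Read a e1 => if eval s e1 is Some i then word (arrs s a i) else None
  | Input e1 e2 =>
      if eval s e1 is Some i then
        if eval s e2 is Some j then word (inp i j) else None
      else None
  | Binop op e1 e2 =>
      if eval s e1 is Some v then
        if eval s e2 is Some w then word (eval_binop op v w) else None
      else None
  end.

Fixpoint expr_cost (e : expr) : nat :=
  match e with
  | Const _ | Reg _ => 1
  | Read _ e1 => (expr_cost e1).+1
  | Input e1 e2 | Binop _ e1 e2 => (expr_cost e1 + expr_cost e2).+1
  end.

(* [exec p s t s']: started in s, p halts in state s' after t time units. *)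
Inductive exec : prog -> state -> nat -> state -> Prop :=
  | ExecSkip s : exec Skip s 1 s
  | ExecAssign s x e v :
      eval s e = Some v ->
      exec (Assign x e) s (expr_cost e).+1 (set_reg s x v)
  | ExecWrite s a e1 e2 i v :
      eval s e1 = Some i -> eval s e2 = Some v ->
      exec (Write a e1 e2) s (expr_cost e1 + expr_cost e2).+1 (set_arr s a i v)
  | ExecSeq s s1 s2 p1 p2 t1 t2 :
      exec p1 s t1 s1 -> exec p2 s1 t2 s2 ->
      exec (Seq p1 p2) s (t1 + t2).+1 s2
  | ExecIf s s' e v p1 p2 t :
      eval s e = Some v -> exec (if v != 0 then p1 else p2) s t s' ->
      exec (If e p1 p2) s (expr_cost e + t).+1 s'
  | ExecWhileFalse s e p :
      eval s e = Some 0 -> exec (While e p) s (expr_cost e).+1 s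
  | ExecWhileTrue s s1 s2 e v p t1 t2 :
      eval s e = Some v -> v != 0 ->
      exec p s t1 s1 -> exec (While e p) s1 t2 s2 ->
      exec (While e p) s (expr_cost e + t1 + t2).+1 s2.

Lemma exec_deterministic p s t s' t1 s1 :
  exec p s t s' -> exec p s t1 s1 -> t = t1 /\ s' = s1.
Proof.
move=> H; elim: H t1 s1 => {p s t s'}.
- by move=> s t1 s1 H; inversion H.
- by move=> s x e v E t1 s1 H; inversion H; split; congruence.
- by move=> s a e1 e2 i v E1 E2 t1 s1 H; inversion H; split; congruence.
- move=> s sa sb p1 p2 ta tb _ IH1 _ IH2 t1 s1 H; inversion H; subst.
  case: (IH1 _ _ ltac:(eassumption)) => ? ?; subst.
  by case: (IH2 _ _ ltac:(eassumption)) => ? ?; subst.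
- move=> s s' e v p1 p2 t E _ IH t1 s1 H; inversion H; subst.
  have ? : v = v0 by congruence.
  by subst; case: (IH _ _ ltac:(eassumption)) => ? ?; subst.
- move=> s e p E t1 s1 H; inversion H as
    [| | | | | |? ? ? ? v ? ? ? E' nz]; subst => //.
  by move: nz; rewrite E in E'; case: E' => <-.
- move=> s sa sb e v p ta tb E nz _ IH1 _ IH2 t1 s1 H.
  inversion H as [| | | | |? ? ? E'|? ? ? ? ? ? ? ? _ _ H1 H2]; subst.
    by move: nz; rewrite E in E'; case: E' => ->.
  case: (IH1 _ _ H1) => ? ?; subst.
  by case: (IH2 _ _ H2) => ? ?; subst.
Qed.

End Semantics.

(** * Encoding of inputs and outputs *)

(* Vertices are 0, ..., n-1.  The entry of a pair of distinct vertices is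
   theta + 1, that is 0, 1 or 2; all other entries are 0. *)
Definition input_matrix (n : nat) (T : trigraph 'I_n) (i j : nat) : nat :=
  match (insub i : option 'I_n), (insub j : option 'I_n) with
  | Some u, Some v => if u == v then 0 else absz (theta T [set u; v] + 1)%R
  | _, _ => 0
  end.

Definition init_state (n : nat) : state :=
  State (fun x => if x == 0 then n else 0) (fun _ _ => 0).

(* Register 1 holds the kind of the answer; array 0 labels the vertices of the
   first set of the answer by 1 and those of the second set by 2. *)
Definition decode_output (n : nat) (s : state) : option (output 'I_n) :=
  let S1 := [set i : 'I_n | arrs s 0 i == 1] in
  let S2 := [set i : 'I_n | arrs s 0 i == 2] in
  match regs s 1 with
  | 1 => Some (OutPair S1 S2)
  | 2 => Some (OutCut S1 S2)
  | 3 => Some (OutNone 'I_n)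
  | _ => None
  end.

(* Main.v *)
Require Import Defs.
From mathcomp Require Import all_boot all_order all_algebra.
From mathcomp Require Import zify.
From Stdlib Require Import FunctionalExtensionality.
Set Implicit Arguments.
Unset Strict Implicit.
Unset Printing Implicit Defensive.

(** A homogeneous pair with at most 6 vertices is found by trying every labelling
    of at most 6 vertices by the two sides, each tested in quadratic time.

    For homogeneous cuts, fix [c] in the part C and [d] in the part D of the split
    of a proper pair (A, B).  A vertex can be in A only if it is strongly adjacent
    to [c] and strongly antiadjacent to [d], and in B only in the opposite case, so
    the side of a vertex is forced.  Three vertices of A and B already witness that
    A is neither strongly complete nor strongly anticomplete to B and that there are
    at least three vertices.  Starting from them, add every vertex that is mixed on
    one of the two sides, until this stops: the result lies inside every proper pair
    having these seeds, with [c] in C and [d] in D.  The same closure with a single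
    side and two seeds finds homogeneous sets.  Since n rounds of quadratic cost
    suffice, all n^5 choices of (c, d, x, y, z) take time O(n^8), and a smallest set
    obtained in this way is the side of a minimally-sided cut. *)

(** Soundness and completeness are kept apart. Each candidate labelling is tested afresh by a
    first-order formula, so a wrong guess of a tuple yields either a rejected candidate or a genuine
    answer. The closure serves only to show that each cut with side [X] is matched by some tuple
    whose candidate is valid and has at most [#|X|] vertices. The recorded cut therefore has minimum
    cardinality among all cuts, which is stronger than minimality under inclusion. The obstacle is
    accounting: cost is counted on a concrete machine with bounded words. All tests and updates are
    therefore written in a small logic whose compiled code has the quantifier depth as the exponent
    of its running time. Six loops and a test of depth 2 give exponent 8 for small pairs. The choice
    of sides costs only a constant there, because an entry ranges over [2n] values and encodes a
    vertex together with its side. *)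

(** * Instances and their input matrix *)

Record env := Env { sz : nat; tg : trigraph 'I_sz }.

Definition mat (E : env) : nat -> nat -> nat := input_matrix (tg E).
Definition wbound (E : env) : nat := (sz E).+2 ^ 8.

Lemma mat_ord (E : env) (i j : 'I_(sz E)) :
  mat E i j = if i == j then 0 else absz (theta (tg E) [set i; j] + 1)%R.
Proof. by rewrite /mat /input_matrix !valK. Qed.

Lemma theta_cases (E : env) (i j : 'I_(sz E)) : i != j ->
  [\/ theta (tg E) [set i; j] = (-1)%R, theta (tg E) [set i; j] = 0%R
    | theta (tg E) [set i; j] = 1%R].
Proof.
move=> ij; have /(thetaP (tg E)) : #|[set i; j]| = 2 by rewrite cards2 ij.
by rewrite !inE => /or3P[] /eqP; [exact: Or31|exact: Or32|exact: Or33].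
Qed.

Lemma mat_le2 (E : env) i j : mat E i j <= 2.
Proof.
rewrite /mat /input_matrix; case: insubP => // u _ _; case: insubP => // v _ _.
by case: eqVneq => // /theta_cases[] ->.
Qed.

Lemma mat_adj (E : env) (i j : 'I_(sz E)) :
  (mat E i j == 2) = strongly_adjacent (tg E) i j.
Proof.
rewrite mat_ord /strongly_adjacent; case: (eqVneq i j) => //= ij.
by case: (theta_cases ij) => ->.
Qed.

(** The diagonal of the matrix is 0, which is also the code of strong antiadjacency, so this test
    needs the extra disequality. The code 2 never occurs on the diagonal. *)
Lemma mat_anti (E : env) (i j : 'I_(sz E)) :
  (mat E i j == 0) && ~~ (i == j :> nat) = strongly_antiadjacent (tg E) i j.
Proof.
rewrite mat_ord /strongly_antiadjacent (inj_eq val_inj).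
case: (eqVneq i j) => //= ij; rewrite andbT.
by case: (theta_cases ij) => ->.
Qed.

(** * Timed Hoare triples *)

Section Runs.
Variable E : env.

(** The bound [2n + 8] leaves room for counters running up to [2n] and for small literals. Array
    entries are labels; 3 occurs when both bits of a [TLab] are set. *)
Definition wfs (s : state) : Prop :=
  [/\ regs s 0 = sz E, forall x, regs s x <= (sz E).*2 + 8
    & forall a i, arrs s a i <= 3].

Fixpoint ev (s : state) (e : expr) : nat :=
  match e with
  | Const k => k
  | Reg x => regs s x
  | Read a e1 => arrs s a (ev s e1)
  | Input e1 e2 => mat E (ev s e1) (ev s e2)
  | Binop op e1 e2 => eval_binop op (ev s e1) (ev s e2)
  end.

Definition runs p s B (Q : state -> Prop) :=
  exists t s', [/\ exec (wbound E) (mat E) p s t s', t <= B & Q s'].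

End Runs.

(** The result is a coefficient of [n + 2]. A register gets 4 because [2n + 8] is at most four times
    [n + 2]. *)
Fixpoint ebound (e : expr) : nat :=
  match e with
  | Const k => k
  | Reg _ => 4
  | Read _ _ => 3
  | Input _ _ => 2
  | Binop Defs.Add e1 e2 => ebound e1 + ebound e2
  | Binop Defs.Sub e1 _ => ebound e1
  | Binop _ _ _ => 1
  end.

Fixpoint esafe (e : expr) : bool :=
  (ebound e < 100) &&
  match e with
  | Const _ | Reg _ => true
  | Read _ e1 => esafe e1
  | Input e1 e2 | Binop _ e1 e2 => esafe e1 && esafe e2
  end.

Lemma ev_le E s e : wfs E s -> ev E s e <= ebound e * (sz E).+2.
Proof.
case=> _ hr ha; elim: e => /=.
- by move=> k; nia.
- by move=> x; move: (hr x); lia.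
- by move=> a e _; move: (ha a (ev E s e)); lia.
- by move=> e1 _ e2 _; move: (mat_le2 E (ev E s e1) (ev E s e2)); lia.
- move=> [] e1 IH1 e2 IH2 /=; try lia.
Qed.

Lemma wbound_ge E k : k < 100 -> k * (sz E).+2 < wbound E.
Proof.
move=> k100; rewrite /wbound expnSr ltn_pmul2r //.
(* One factor [n + 2] has been cancelled; the seven that remain are each at least 2, and
   [2 ^ 7 = 128] exceeds every [k < 100]. *)
by apply: (@leq_trans (2 ^ 7)); [apply: leq_trans k100 _ | rewrite leq_exp2r].
Qed.

Lemma evalE E s e : wfs E s -> esafe e ->
  eval (wbound E) (mat E) s e = Some (ev E s e).
Proof.
move=> hs; have W e' : ebound e' < 100 -> word (wbound E) (ev E s e') = Some (ev E s e').
  by move=> h; rewrite /word (leq_ltn_trans (ev_le e' hs) (wbound_ge _ h)).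
elim: e => [k|x|a e IH|e1 IH1 e2 IH2|op e1 IH1 e2 IH2] /=.
- by rewrite andbT; apply: (W (Const k)).
- by move=> _; apply: (W (Reg x)).
- by move=> /IH ->; apply: (W (Read a e)).
- by move=> /andP[/IH1 -> /IH2 ->]; apply: (W (Input e1 e2)).
- by move=> /andP[hb /andP[/IH1 -> /IH2 ->]]; apply: (W (Binop op e1 e2)).
Qed.

Definition pre := env -> state -> Prop.
Definition post := env -> state -> state -> Prop.

(* The constant [K] is chosen before the instance, so [k] is the exponent of a
   uniform polynomial time bound. *)
Definition triple (k : nat) (p : prog) (P : pre) (Q : post) : Prop :=
  exists K, forall E s, wfs E s -> P E s ->
    runs E p s (K * (sz E).+1 ^ k) (fun s' => wfs E s' /\ Q E s s').

Lemma triple_conseq k p P Q k' (P' : pre) (Q' : post) :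
  triple k p P Q -> k <= k' ->
  (forall E s, wfs E s -> P' E s -> P E s /\
     forall s', wfs E s' -> Q E s s' -> Q' E s s') ->
  triple k' p P' Q'.
Proof.
move=> [K H] kk PQ; exists K => E s hs hP'; have [hP hQ] := PQ _ _ hs hP'.
have [t [s' [ex tB [ws Qs]]]] := H _ _ hs hP.
exists t, s'; split=> //; last by split=> //; apply: hQ.
by apply: leq_trans tB _; rewrite leq_mul2l leq_pexp2l ?orbT.
Qed.

Lemma wfs_set_reg E s x v : wfs E s -> x != 0 -> v <= (sz E).*2 + 8 ->
  wfs E (set_reg s x v).
Proof.
move=> [h0 hr ha] x0 hv; split=> //= [|y]; last by case: ifP.
by rewrite eq_sym (negbTE x0).
Qed.

Lemma wfs_set_arr E s a i v : wfs E s -> v <= 3 -> wfs E (set_arr s a i v).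
Proof. by move=> [h0 hr ha] hv; split=> //= b j; case: ifP. Qed.

Lemma triple_skip : triple 0 Skip (fun _ _ => True) (fun _ s s' => s' = s).
Proof. by exists 1 => E s hs _; exists 1, s; split=> //; constructor. Qed.

Lemma triple_assign x e : x != 0 -> esafe e ->
  triple 0 (Assign x e) (fun E s => ev E s e <= (sz E).*2 + 8)
    (fun E s s' => s' = set_reg s x (ev E s e)).
Proof.
move=> x0 he; exists (expr_cost e).+1 => E s hs hb.
exists (expr_cost e).+1, (set_reg s x (ev E s e)); split.
- by constructor; apply: evalE.
- by rewrite muln1.
- by split=> //; apply: wfs_set_reg.
Qed.

Lemma triple_write a e1 e2 : esafe e1 -> esafe e2 ->
  triple 0 (Write a e1 e2) (fun E s => ev E s e2 <= 3)
    (fun E s s' => s' = set_arr s a (ev E s e1) (ev E s e2)).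
Proof.
move=> h1 h2; exists (expr_cost e1 + expr_cost e2).+1 => E s hs hb.
exists (expr_cost e1 + expr_cost e2).+1, (set_arr s a (ev E s e1) (ev E s e2)).
split; first by constructor; apply: evalE.
  by rewrite muln1.
by split=> //; apply: wfs_set_arr.
Qed.

Lemma triple_seq k p q (P : pre) (Q1 : post) (P2 : pre) (Q2 Q : post) :
  triple k p P Q1 -> triple k q P2 Q2 ->
  (forall E s s1, wfs E s -> P E s -> wfs E s1 -> Q1 E s s1 ->
     P2 E s1 /\ forall s2, wfs E s2 -> Q2 E s1 s2 -> Q E s s2) ->
  triple k (Seq p q) P Q.
Proof.
move=> [K1 H1] [K2 H2] H; exists (K1 + K2).+1 => E s hs hP.
have [t1 [s1 [ex1 tB1 [ws1 Qs1]]]] := H1 _ _ hs hP.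
have [hP2 hQ] := H _ _ _ hs hP ws1 Qs1.
have [t2 [s2 [ex2 tB2 [ws2 Qs2]]]] := H2 _ _ ws1 hP2.
exists (t1 + t2).+1, s2; split; [exact: ExecSeq ex1 ex2| |by split; auto].
have: 0 < (sz E).+1 ^ k by rewrite expn_gt0.
by rewrite mulSn mulnDl; lia.
Qed.

Lemma triple_if k e p q (P : pre) (Q : post) : esafe e ->
  triple k p (fun E s => P E s /\ ev E s e != 0) Q ->
  triple k q (fun E s => P E s /\ ev E s e = 0) Q ->
  triple k (If e p q) P Q.
Proof.
move=> he [K1 H1] [K2 H2]; exists (K1 + K2 + expr_cost e).+1 => E s hs hP.
have pos : 0 < (sz E).+1 ^ k by rewrite expn_gt0.
have B t K : K <= K1 + K2 -> t <= K * (sz E).+1 ^ k ->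
    (expr_cost e + t).+1 <= (K1 + K2 + expr_cost e).+1 * (sz E).+1 ^ k by nia.
have [z|nz] := eqVneq (ev E s e) 0.
  have [t [s' [ex tB Qs]]] := H2 _ _ hs (conj hP z).
  exists (expr_cost e + t).+1, s'; split=> //; last by apply: B tB; lia.
  by apply: ExecIf (evalE hs he) _; rewrite z.
have [t [s' [ex tB Qs]]] := H1 _ _ hs (conj hP nz).
exists (expr_cost e + t).+1, s'; split=> //; last by apply: B tB; lia.
by apply: ExecIf (evalE hs he) _; rewrite nz.
Qed.

Definition For (x y : nat) (p : prog) : prog :=
  Seq (Assign x (Const 0))
    (While (Binop Defs.Lt (Reg x) (Reg y))
       (Seq p (Assign x (Binop Defs.Add (Reg x) (Const 1))))).

(** [Inv E s0 i s] relates the entry state [s0] to the state after [i] complete rounds, with the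
    counter already increased. One power of n is added because every register, hence the loop bound,
    is linear in n. *)
Lemma triple_for k x y p (P PB : pre) (QB : post)
    (Inv : env -> state -> nat -> state -> Prop) :
  x != 0 -> x != y ->
  triple k p PB QB ->
  (forall E s, wfs E s -> P E s -> Inv E s 0 (set_reg s x 0)) ->
  (forall E s0 i s, wfs E s0 -> P E s0 -> wfs E s -> Inv E s0 i s ->
     regs s x = i -> i < regs s0 y -> regs s y = regs s0 y ->
     PB E s /\
     forall s', wfs E s' -> QB E s s' ->
       [/\ regs s' x = i, regs s' y = regs s y & Inv E s0 i.+1 (set_reg s' x i.+1)]) ->
  triple k.+1 (For x y p) P (fun E s s' => Inv E s (regs s y) s').
Proof.
move=> x0 xy [K H] Hi Hs; exists (8 * (K + 12) + 10) => E s0 hs0 hP.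
set N := regs s0 y; set m := (sz E).+1.
have hN : N <= 8 * m.
  by case: hs0 => _ h _; have := h y; rewrite -/N /m; lia.
have pos : 0 < m ^ k by rewrite expn_gt0.
(* [d] counts the remaining rounds. Guard, increment and sequencing cost 9 units per round, which 12
   covers; the last 4 units pay for the failing guard. *)
have loop d i s : d + i = N -> wfs E s -> Inv E s0 i s -> regs s x = i ->
    regs s y = N ->
    runs E (While (Binop Defs.Lt (Reg x) (Reg y))
       (Seq p (Assign x (Binop Defs.Add (Reg x) (Const 1))))) s
     (d * (K * m ^ k + 12) + 4) (fun s' => wfs E s' /\ Inv E s0 N s').
  elim: d i s => [|d IH] i s.
    rewrite add0n => -> hs hI sx sy; exists 4, s; split=> //.
    apply: ExecWhileFalse; rewrite evalE //= sx sy; congr Some.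
    by rewrite ltnn.
  move=> di hs hI sx sy; have iN : i < regs s0 y by rewrite -/N; lia.
  have [hPB hQ] := Hs E s0 i s hs0 hP hs hI sx iN sy.
  have [t [s' [ex tB [ws' Qs']]]] := H _ _ hs hPB.
  have [s'x s'y hI'] := hQ _ ws' Qs'.
  have ws2 : wfs E (set_reg s' x i.+1).
    by apply: wfs_set_reg => //; case: hs0 => _ h _; exact: leq_trans iN (h y).
  have [|||t2 [s2 [ex2 tB2 Q2]]] := IH i.+1 (set_reg s' x i.+1) _ ws2 hI'.
  - by lia.
  - by rewrite /= eqxx.
  - by rewrite /= eq_sym (negbTE xy) s'y sy.
  exists (3 + (t + 4).+1 + t2).+1, s2; split=> //; last first.
    by move: tB; rewrite -/m mulSn; lia.
  apply: ExecWhileTrue ex2.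
  - by apply: evalE.
  - by rewrite /= sx sy /N iN.
  - apply: ExecSeq ex _; rewrite -(_ : ev E s' (Binop Defs.Add (Reg x) (Const 1)) = i.+1).
      by apply: (@ExecAssign _ _ _ _ (Binop Defs.Add (Reg x) (Const 1))); apply: evalE.
    by rewrite /= s'x addn1.
have [|||||t [s' [ex tB [ws' Qs']]]] := loop N 0 (set_reg s0 x 0).
- by rewrite addn0.
- by apply: wfs_set_reg.
- exact: Hi.
- by rewrite /= eqxx.
- by rewrite /= eq_sym (negbTE xy).
exists (2 + t).+1, s'; split=> //.
  by apply: ExecSeq ex; apply: (@ExecAssign _ _ _ _ (Const 0)); apply: evalE.
rewrite expnSr mulnA -/m.
have h1 : t <= 8 * m * ((K + 12) * m ^ k) + 4.
  by apply: leq_trans tB _; rewrite leq_add2r leq_mul //; nia.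
have h2 : 1 <= m by [].
set u := m ^ k in pos h1 *; rewrite mulnDl mulnDl.
have -> : 8 * (K + 12) * u * m = 8 * m * ((K + 12) * u) by lia.
nia.
Qed.

(** * A first-order language with counting, compiled to the RAM *)

(* [GV x] is the register [x]; [BV i] is a de Bruijn index into the variables
   bound by [TCount], [FEx] and [FAll], which range over the vertices. *)
Variant var := GV of nat | BV of nat.

Inductive term :=
  | TConst of nat
  | TVar of var
  | TArr of nat & var
  | TIn of var & var
  | TSub of term & term
  | TCount of formula
  | TLab of formula & formula
with formula :=
  | FEq of term & term
  | FLt of term & term
  | FAnd of formula & formula
  | FOr of formula & formula
  | FNot of formula
  | FEx of formula
  | FAll of formula.

Scheme term_mut := Induction for term Sort Prop
with form_mut := Induction for formula Sort Prop.
Combined Scheme term_form_ind from term_mut, form_mut.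

Section Denotation.
Variables (E : env) (rho : nat -> nat) (A : nat -> nat -> nat).

(** The default [sz E] mirrors the compiler: an index out of range is sent to register 0, which
    holds n. *)
Definition vval (vals : seq nat) (v : var) : nat :=
  match v with GV x => rho x | BV i => nth (sz E) vals i end.

Fixpoint den (vals : seq nat) (t : term) : nat :=
  match t with
  | TConst k => k
  | TVar v => vval vals v
  | TArr a v => A a (vval vals v)
  | TIn v w => mat E (vval vals v) (vval vals w)
  | TSub t1 t2 => den vals t1 - den vals t2
  | TCount f => #|[pred i : 'I_(sz E) | sat (val i :: vals) f]|
  | TLab f g => sat vals f + (sat vals g).*2
  end
with sat (vals : seq nat) (f : formula) : bool :=
  match f with
  | FEq t1 t2 => den vals t1 == den vals t2
  | FLt t1 t2 => den vals t1 < den vals t2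
  | FAnd f1 f2 => sat vals f1 && sat vals f2
  | FOr f1 f2 => sat vals f1 || sat vals f2
  | FNot f1 => ~~ sat vals f1
  | FEx f1 => [exists i : 'I_(sz E), sat (val i :: vals) f1]
  | FAll f1 => [forall i : 'I_(sz E), sat (val i :: vals) f1]
  end.

End Denotation.

Definition vglob (v : var) : seq nat := if v is GV x then [:: x] else [::].

Fixpoint tglob (t : term) : seq nat :=
  match t with
  | TConst _ => [::]
  | TVar v | TArr _ v => vglob v
  | TIn v w => vglob v ++ vglob w
  | TSub t1 t2 => tglob t1 ++ tglob t2
  | TCount f => fglob f
  | TLab f g => fglob f ++ fglob g
  end
with fglob (f : formula) : seq nat :=
  match f with
  | FEq t1 t2 | FLt t1 t2 => tglob t1 ++ tglob t2
  | FAnd f1 f2 | FOr f1 f2 => fglob f1 ++ fglob f2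
  | FNot f1 | FEx f1 | FAll f1 => fglob f1
  end.

Fixpoint tarrs (t : term) : seq nat :=
  match t with
  | TConst _ | TVar _ | TIn _ _ => [::]
  | TArr a _ => [:: a]
  | TSub t1 t2 => tarrs t1 ++ tarrs t2
  | TCount f => farrs f
  | TLab f g => farrs f ++ farrs g
  end
with farrs (f : formula) : seq nat :=
  match f with
  | FEq t1 t2 | FLt t1 t2 => tarrs t1 ++ tarrs t2
  | FAnd f1 f2 | FOr f1 f2 => farrs f1 ++ farrs f2
  | FNot f1 | FEx f1 | FAll f1 => farrs f1
  end.

(** Each count or quantifier is compiled to one loop over the vertices, so this depth is the
    exponent of the running time of the code. *)
Fixpoint tdepth (t : term) : nat :=
  match t with
  | TConst _ | TVar _ | TIn _ _ | TArr _ _ => 0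
  | TSub t1 t2 => maxn (tdepth t1) (tdepth t2)
  | TCount f => (fdepth f).+1
  | TLab f g => maxn (fdepth f) (fdepth g)
  end
with fdepth (f : formula) : nat :=
  match f with
  | FEq t1 t2 | FLt t1 t2 => maxn (tdepth t1) (tdepth t2)
  | FAnd f1 f2 | FOr f1 f2 => maxn (fdepth f1) (fdepth f2)
  | FNot f1 => fdepth f1
  | FEx f1 | FAll f1 => (fdepth f1).+1
  end.

Fixpoint tconst (t : term) : bool :=
  match t with
  | TConst k => k <= 8
  | TVar _ | TIn _ _ | TArr _ _ => true
  | TSub t1 t2 => tconst t1 && tconst t2
  | TCount f => fconst f
  | TLab f g => fconst f && fconst g
  end
with fconst (f : formula) : bool :=
  match f with
  | FEq t1 t2 | FLt t1 t2 => tconst t1 && tconst t2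
  | FAnd f1 f2 | FOr f1 f2 => fconst f1 && fconst f2
  | FNot f1 | FEx f1 | FAll f1 => fconst f1
  end.

Lemma den_sat_ext E rho rho' A A' :
  (forall t vals, {in tglob t, rho =1 rho'} -> {in tarrs t, A =1 A'} ->
     den E rho A vals t = den E rho' A' vals t) /\
  (forall f vals, {in fglob f, rho =1 rho'} -> {in farrs f, A =1 A'} ->
     sat E rho A vals f = sat E rho' A' vals f).
Proof.
have V vals v : {in vglob v, rho =1 rho'} -> vval E rho vals v = vval E rho' vals v.
  by case: v => //= x -> //; rewrite mem_head.
have CL (s1 s2 : seq nat) (B : Type) (h h' : nat -> B) :
    {in s1 ++ s2, h =1 h'} -> {in s1, h =1 h'} /\ {in s2, h =1 h'}.
  by move=> H; split=> x xs; apply: H; rewrite mem_cat xs ?orbT.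
apply: term_form_ind => //=.
- by move=> v vals /V ->.
- by move=> a v vals /V -> -> //; rewrite mem_head.
- by move=> v w vals /CL[/V -> /V ->].
- by move=> t1 IH1 t2 IH2 vals /CL[g1 g2] /CL[a1 a2]; rewrite IH1 ?IH2.
- by move=> f IH vals g a; apply: eq_card => i; rewrite !inE IH.
- by move=> f1 IH1 f2 IH2 vals /CL[g1 g2] /CL[a1 a2]; rewrite IH1 ?IH2.
- by move=> t1 IH1 t2 IH2 vals /CL[g1 g2] /CL[a1 a2]; rewrite IH1 ?IH2.
- by move=> t1 IH1 t2 IH2 vals /CL[g1 g2] /CL[a1 a2]; rewrite IH1 ?IH2.
- by move=> t1 IH1 t2 IH2 vals /CL[g1 g2] /CL[a1 a2]; rewrite IH1 ?IH2.
- by move=> t1 IH1 t2 IH2 vals /CL[g1 g2] /CL[a1 a2]; rewrite IH1 ?IH2.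
- by move=> f IH vals g a; rewrite IH.
- by move=> f IH vals g a; apply: eq_existsb => i; rewrite IH.
- by move=> f IH vals g a; apply: eq_forallb => i; rewrite IH.
Qed.

(** * Compilation of terms and formulas, and its correctness *)

Definition vreg (ctx : seq nat) (v : var) : nat :=
  match v with GV x => x | BV i => nth 0 ctx i end.

Definition bin_code (r : nat) (p q : prog) (e : expr) : prog :=
  Seq p (Seq q (Assign r e)).

Definition count_code (r : nat) (p : prog) : prog :=
  Seq (Assign r (Const 0))
    (For r.+1 0
       (Seq p (Assign r (Binop Defs.Add (Reg r)
                           (Binop Defs.Lt (Const 0) (Reg r.+2)))))).

(* The value is left in register [r]; registers below [r] are preserved. *)
Fixpoint tcode (r : nat) (ctx : seq nat) (t : term) : prog :=
  match t with
  | TConst k => Assign r (Const k)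
  | TVar v => Assign r (Reg (vreg ctx v))
  | TArr a v => Assign r (Read a (Reg (vreg ctx v)))
  | TIn v w => Assign r (Input (Reg (vreg ctx v)) (Reg (vreg ctx w)))
  | TSub t1 t2 => bin_code r (tcode r ctx t1) (tcode r.+1 ctx t2)
                    (Binop Defs.Sub (Reg r) (Reg r.+1))
  | TCount f => count_code r (fcode r.+2 (r.+1 :: ctx) f)
  | TLab f g => bin_code r (fcode r ctx f) (fcode r.+1 ctx g)
      (Binop Defs.Add (Reg r) (Binop Defs.Add (Reg r.+1) (Reg r.+1)))
  end
with fcode (r : nat) (ctx : seq nat) (f : formula) : prog :=
  match f with
  | FEq t1 t2 => bin_code r (tcode r ctx t1) (tcode r.+1 ctx t2)
                    (Binop Defs.Eq (Reg r) (Reg r.+1))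
  | FLt t1 t2 => bin_code r (tcode r ctx t1) (tcode r.+1 ctx t2)
                    (Binop Defs.Lt (Reg r) (Reg r.+1))
  | FAnd f1 f2 => bin_code r (fcode r ctx f1) (fcode r.+1 ctx f2)
      (Binop Defs.Lt (Const 1) (Binop Defs.Add (Reg r) (Reg r.+1)))
  | FOr f1 f2 => bin_code r (fcode r ctx f1) (fcode r.+1 ctx f2)
      (Binop Defs.Lt (Const 0) (Binop Defs.Add (Reg r) (Reg r.+1)))
  | FNot f1 => Seq (fcode r ctx f1) (Assign r (Binop Defs.Eq (Reg r) (Const 0)))
  | FEx f1 => Seq (count_code r (fcode r.+2 (r.+1 :: ctx) f1))
                (Assign r (Binop Defs.Lt (Const 0) (Reg r)))
  | FAll f1 => Seq (count_code r (fcode r.+2 (r.+1 :: ctx) f1))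
                (Assign r (Binop Defs.Eq (Reg r) (Reg 0)))
  end.

Definition valuation := env -> (nat -> nat) -> (nat -> nat -> nat) -> seq nat -> nat.

Definition computes (r : nat) (ctx : seq nat) (k : nat) (p : prog)
    (v : valuation) : Prop :=
  triple k p (fun _ _ => True)
    (fun E s s' => [/\ forall y, y < r -> regs s' y = regs s y,
                       arrs s' = arrs s
                     & regs s' r = v E (regs s) (arrs s) (map (regs s) ctx)]).

(** A second operand or a loop body is evaluated after registers from [r] on have been overwritten;
    locality says that its value is still the one in the initial state. *)
Definition local (r : nat) (v : valuation) : Prop :=
  forall E rho rho' A vals, (forall y, y < r -> rho y = rho' y) ->
    v E rho A vals = v E rho' A vals.

Lemma map_regs_eq (r : nat) (ctx : seq nat) (rho rho' : nat -> nat) :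
  all (fun x => x < r) ctx -> (forall y, y < r -> rho y = rho' y) ->
  map rho ctx = map rho' ctx.
Proof. by move=> /allP h e; apply/eq_in_map => x /h /e. Qed.

Lemma computes_ext r ctx k p v v' :
  (forall E s, wfs E s ->
     v E (regs s) (arrs s) (map (regs s) ctx) = v' E (regs s) (arrs s) (map (regs s) ctx)) ->
  computes r ctx k p v -> computes r ctx k p v'.
Proof.
move=> e h; apply: triple_conseq h _ _ => // E s hs _; split=> // s' _ [? ? ->].
by rewrite e.
Qed.

Lemma computes_assign r ctx e (v : valuation) : 0 < r -> esafe e ->
  (forall E s, wfs E s -> ev E s e = v E (regs s) (arrs s) (map (regs s) ctx)) ->
  (forall E s, wfs E s -> ev E s e <= (sz E).*2 + 8) ->
  computes r ctx 0 (Assign r e) v.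
Proof.
move=> r0 he hv hb; apply: triple_conseq (triple_assign _ he) _ _ => //.
  by rewrite -lt0n.
move=> E s hs _; split; first exact: hb.
move=> s' _ ->; split=> //= [y yr|]; first by rewrite ltn_eqF.
by rewrite eqxx hv.
Qed.

Lemma computes_un r ctx k p v e (op : env -> nat -> nat) : 0 < r -> esafe e ->
  computes r ctx k p v ->
  (forall E s, wfs E s -> ev E s e = op E (regs s r)) ->
  (forall E a, op E a <= (sz E).*2 + 8) ->
  computes r ctx k (Seq p (Assign r e))
    (fun E rho A vals => op E (v E rho A vals)).
Proof.
move=> r0 he hp hop hb; have r0' : r != 0 by rewrite -lt0n.
apply: triple_seq hp _ _.
  apply: (@triple_conseq _ _ _ _ _ (fun _ _ => True)); first exact: triple_assign he.
    by [].
  by move=> E s hs _; split=> [|s' _ h]; [rewrite hop|exact: h].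
move=> E s s1 hs _ hs1 [k1 k2 k3]; split=> // s2 hs2 ->; split=> //= [y yr|].
  by rewrite ltn_eqF // k1.
by rewrite eqxx hop // k3.
Qed.

(** [ok] carries what is known about the operand values when the register bound alone does not bound
    the result: for [TLab] both are truth values, so [a + (b + b)] stays small. *)
Lemma computes_bin r ctx k1 k2 p1 p2 v1 v2 e (op : nat -> nat -> nat)
    (ok : env -> nat -> nat -> bool) :
  0 < r -> esafe e -> all (fun x => x < r) ctx ->
  computes r ctx k1 p1 v1 -> computes r.+1 ctx k2 p2 v2 -> local r v2 ->
  (forall E s, ev E s e = op (regs s r) (regs s r.+1)) ->
  (forall E a b, a <= (sz E).*2 + 8 -> ok E a b -> op a b <= (sz E).*2 + 8) ->
  (forall E rho A vals, ok E (v1 E rho A vals) (v2 E rho A vals)) ->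
  computes r ctx (maxn k1 k2) (bin_code r p1 p2 e)
    (fun E rho A vals => op (v1 E rho A vals) (v2 E rho A vals)).
Proof.
move=> r0 he hctx h1 h2 loc hop hb hok; have r0' : r != 0 by rewrite -lt0n.
have h1' : computes r ctx (maxn k1 k2) p1 v1.
  by apply: triple_conseq h1 _ _ => //; exact: leq_maxl.
have h2' : computes r.+1 ctx (maxn k1 k2) p2 v2.
  by apply: triple_conseq h2 _ _ => //; exact: leq_maxr.
have h3 : triple (maxn k1 k2) (Assign r e)
    (fun E s => ev E s e <= (sz E).*2 + 8)
    (fun E s s' => s' = set_reg s r (ev E s e)).
  apply: triple_conseq (triple_assign r0' he) _ _ => //.
have h2'' : triple (maxn k1 k2) p2
    (fun E s => ok E (regs s r) (v2 E (regs s) (arrs s) (map (regs s) ctx)))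
    (fun E s s' => [/\ forall y, y < r.+1 -> regs s' y = regs s y,
       arrs s' = arrs s
     & regs s' r.+1 = v2 E (regs s) (arrs s) (map (regs s) ctx)]).
  by apply: triple_conseq h2' _ _.
have h23 : triple (maxn k1 k2) (Seq p2 (Assign r e))
    (fun E s => ok E (regs s r) (v2 E (regs s) (arrs s) (map (regs s) ctx)))
    (fun E s s' => [/\ forall y, y < r -> regs s' y = regs s y, arrs s' = arrs s
      & regs s' r = op (regs s r) (v2 E (regs s) (arrs s) (map (regs s) ctx))]).
  apply: triple_seq h2'' h3 _ => E s s1 hs okk hs1 [k1' k2' k3']; split.
    rewrite hop k3'; apply: hb; first by case: hs1.
    by rewrite k1' ?ltnSn.
  move=> s2 hs2 ->; split=> //= [y yr|].
    by rewrite ltn_eqF // k1' // ltnW.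
  by rewrite eqxx hop k3' k1'.
apply: triple_seq h1' h23 _.
move=> E s s1 hs _ hs1 [k1' k2' k3'].
have eqv : v2 E (regs s1) (arrs s1) (map (regs s1) ctx) =
             v2 E (regs s) (arrs s) (map (regs s) ctx).
    by rewrite k2' (map_regs_eq hctx k1'); apply: loc.
  split; first by rewrite k3' eqv.
  move=> s2 hs2 [k1'' k2'' k3'']; split.
  + by move=> y yr; rewrite k1'' // k1'.
  + by rewrite k2''.
  + by rewrite k3'' k3' eqv.
Qed.

Lemma card_ord_count n (P : pred nat) :
  #|[pred i : 'I_n | P i]| = count P (iota 0 n).
Proof.
by rewrite -sum1_card -sum1_count -[in RHS](subn0 n) -/(index_iota 0 n) big_mkord.
Qed.

Lemma computes_count r ctx k p (v : env -> (nat -> nat) -> (nat -> nat -> nat) -> seq nat -> bool) :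
  0 < r -> all (fun x => x < r) ctx ->
  computes r.+2 (r.+1 :: ctx) k p v -> local r v ->
  computes r ctx k.+1 (count_code r p)
    (fun E rho A vals => #|[pred i : 'I_(sz E) | v E rho A (val i :: vals)]|).
Proof.
move=> r0 hctx hp loc; have r0' : r != 0 by rewrite -lt0n.
have ha : triple k.+1 (Assign r (Const 0)) (fun _ _ => True)
    (fun E s s' => s' = set_reg s r 0).
  by apply: triple_conseq (triple_assign r0' _) _ _.
pose cnt E s i := count (fun j => v E (regs s) (arrs s) (j :: map (regs s) ctx)) (iota 0 i).
pose Inv (E : env) (s0 : state) (i : nat) (s : state) :=
  [/\ forall y, y < r -> regs s y = regs s0 y, arrs s = arrs s0
    & regs s r = cnt E s0 i].
have hp' : triple k p (fun E s => regs s r <= sz E)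
    (fun E s s' => [/\ forall y, y < r.+2 -> regs s' y = regs s y, arrs s' = arrs s
      & regs s' r.+2 = v E (regs s) (arrs s) (map (regs s) (r.+1 :: ctx))]).
  by apply: triple_conseq hp _ _.
have hb : triple k (Seq p (Assign r (Binop Defs.Add (Reg r)
                           (Binop Defs.Lt (Const 0) (Reg r.+2)))))
    (fun E s => regs s r <= sz E)
    (fun E s s' => [/\ forall y, y < r -> regs s' y = regs s y,
        arrs s' = arrs s, regs s' r.+1 = regs s r.+1
        & regs s' r = regs s r + v E (regs s) (arrs s) (map (regs s) (r.+1 :: ctx))]).
  apply: triple_seq hp' (triple_conseq (triple_assign r0' _) (leq0n k) _) _ => //.
    by move=> E s hs h; split; [exact: h|move=> s' _ h'; exact: h'].
  move=> E s s1 hs le hs1 [k1 k2 k3]; split=> /=.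
    rewrite k1 // k3; move: (v _ _ _ _) => b; move: le; case: b => /=; lia.
  move=> s2 hs2 ->; split=> //=.
  + by move=> y yr; rewrite ltn_eqF // k1 //; lia.
  + by rewrite gtn_eqF // k1.
  + by rewrite eqxx k1 // k3 lt0b.
have hl : triple k.+1 (For r.+1 0 (Seq p (Assign r (Binop Defs.Add (Reg r)
                           (Binop Defs.Lt (Const 0) (Reg r.+2))))))
    (fun E s => regs s r = 0) (fun E s s' => Inv E s (regs s 0) s').
  apply: triple_for hb _ _ => //.
    by move=> E s hs h; split=> //= [y yr|]; rewrite ltn_eqF // ltnW.
  move=> E s0 i s hs0 h0 hs [i1 i2 i3] sx iN sy.
  have iN' : i < sz E by case: hs0 => <-.
  split; first by rewrite i3 (leq_trans (count_size _ _)) // size_iota ltnW.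
  move=> s' hs' [q1 q2 q3 q4]; split.
  + by rewrite q3.
  + by rewrite q1.
  + split=> /=.
    * by move=> y yr; rewrite ltn_eqF ?q1 ?i1 // ltnW.
    * by rewrite q2.
    * rewrite ltn_eqF // q4 i3 /cnt -[i.+1]addn1 iotaD count_cat /= addn0 add0n.
      by rewrite sx i2 (map_regs_eq hctx i1) (loc _ _ (regs s0)).
apply: triple_seq ha hl _.
- move=> E s s1 hs _ hs1 ->; split; first by rewrite /= eqxx.
  move=> s2 hs2 [q1 q2 q3].
  have a1 y : y < r -> regs (set_reg s r 0) y = regs s y by move=> yr /=; rewrite ltn_eqF.
  split.
  + by move=> y yr; rewrite q1 // a1.
  + by rewrite q2.
  + rewrite q3 a1 //; case: hs => -> _ _; rewrite /cnt.
    rewrite (card_ord_count _ (fun j => v E (regs s) (arrs s) (j :: map (regs s) ctx))).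
    apply: eq_count => j; rewrite (map_regs_eq hctx a1).
    (* [local] compares values as numbers, so the two booleans are identified through their coercion
       to [nat], which [odd] inverts. *)
    by apply: (can_inj oddb); apply: loc.
Qed.

Lemma code_computes :
  (forall t r ctx, 0 < r -> all (fun x => x < r) ctx ->
     all (fun x => x < r) (tglob t) -> tconst t ->
     computes r ctx (tdepth t) (tcode r ctx t) (fun E rho A vals => den E rho A vals t)) /\
  (forall f r ctx, 0 < r -> all (fun x => x < r) ctx ->
     all (fun x => x < r) (fglob f) -> fconst f ->
     computes r ctx (fdepth f) (fcode r ctx f) (fun E rho A vals => sat E rho A vals f)).
Proof.
have V E s ctx v : wfs E s -> regs s (vreg ctx v) = vval E (regs s) (map (regs s) ctx) v.
  case: v => //= i [h0 _ _]; have [lt|ge] := ltnP i (size ctx).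
    by rewrite (nth_map 0).
  by rewrite !nth_default ?size_map.
have LT r t : all (fun x => x < r) (tglob t) ->
    local r (fun E rho A vals => den E rho A vals t).
  by move=> /allP h E rho rho' A vals e; apply: (den_sat_ext _ _ _ _ _).1 => // x /h /e.
have LF r f : all (fun x => x < r) (fglob f) ->
    local r (fun E rho A vals => sat E rho A vals f).
  move=> /allP h E rho rho' A vals e; congr nat_of_bool.
  by apply: (den_sat_ext _ _ _ _ _).2 => // x /h /e.
have SS r (s : seq nat) : all (fun x => x < r) s -> all (fun x => x < r.+1) s.
  by apply: sub_all => x xr; rewrite ltnW.
have CT r (s1 s2 : seq nat) : all (fun x => x < r) (s1 ++ s2) ->
   [/\ all (fun x => x < r) s1, all (fun x => x < r) s2 & all (fun x => x < r.+1) s2].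
  by rewrite all_cat => /andP[h1 h2]; split=> //; apply: SS.
have CNT r ctx f : (forall r ctx, 0 < r -> all (fun x => x < r) ctx ->
     all (fun x => x < r) (fglob f) -> fconst f ->
     computes r ctx (fdepth f) (fcode r ctx f) (fun E rho A vals => sat E rho A vals f)) ->
   0 < r -> all (fun x => x < r) ctx -> all (fun x => x < r) (fglob f) -> fconst f ->
   computes r ctx (fdepth f).+1 (count_code r (fcode r.+2 (r.+1 :: ctx) f))
    (fun E rho A vals => #|[pred i : 'I_(sz E) | sat E rho A (val i :: vals) f]|).
  move=> IH r0 hc hf fc; apply: (computes_count (v := fun E rho A vals => sat E rho A vals f)) => //; last exact: LF.
  by apply: IH => //; rewrite /= ?ltnSn /= !SS.
apply: term_form_ind => /=.
- move=> k r ctx r0 _ _ k8; apply: computes_assign => //= [|E s hs]; last by lia.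
  by rewrite andbT; lia.
- move=> v r ctx r0 _ _ _; apply: computes_assign => //= E s hs; first exact: V.
  by case: hs.
- move=> a v r ctx r0 _ _ _; apply: computes_assign => //= E s hs; first by rewrite (V E).
  by case: hs => _ _ h; apply: leq_trans (h _ _) _; lia.
- move=> v w r ctx r0 _ _ _; apply: computes_assign => //= E s hs; first by rewrite !(V E).
  by apply: leq_trans (mat_le2 _ _ _) _; lia.
- move=> t1 IH1 t2 IH2 r ctx r0 hc /CT[g1 g2 g2'] /andP[c1 c2].
  apply: (computes_bin (op := fun a b => a - b) (ok := fun _ _ _ => true)) => //.
  + exact: IH1.
  + by apply: IH2 => //; apply: SS.
  + exact: LT.
  + by move=> E a b ha _; lia.
- by move=> f IH r ctx r0 hc hf fc; apply: CNT.
- move=> t1 IH1 t2 IH2 r ctx r0 hc /CT[g1 g2 g2'] /andP[c1 c2].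
  apply: (computes_ext (v := fun E rho A vals =>
     sat E rho A vals t1 + (sat E rho A vals t2 + sat E rho A vals t2))).
    by move=> E s _; rewrite addnn.
  apply: (computes_bin (op := fun a b => a + (b + b)) (ok := fun _ a b => (a <= 1) && (b <= 1))) => //.
  + exact: IH1.
  + by apply: IH2 => //; apply: SS.
  + exact: LF.
  + by move=> E a b ha /andP[? ?]; lia.
  + by move=> E rho A vals; rewrite !leq_b1.
- move=> t1 IH1 t2 IH2 r ctx r0 hc /CT[g1 g2 g2'] /andP[c1 c2].
  apply: (computes_bin (op := fun a b => a == b) (ok := fun _ _ _ => true)) => //.
  + exact: IH1.
  + by apply: IH2 => //; apply: SS.
  + exact: LT.
  + by move=> E a b ha _; apply: leq_trans (leq_b1 _) _; lia.
- move=> t1 IH1 t2 IH2 r ctx r0 hc /CT[g1 g2 g2'] /andP[c1 c2].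
  apply: (computes_bin (op := fun a b => a < b) (ok := fun _ _ _ => true)) => //.
  + exact: IH1.
  + by apply: IH2 => //; apply: SS.
  + exact: LT.
  + by move=> E a b ha _; apply: leq_trans (leq_b1 _) _; lia.
- move=> t1 IH1 t2 IH2 r ctx r0 hc /CT[g1 g2 g2'] /andP[c1 c2].
  apply: (computes_ext (v := fun E rho A vals =>
     1 < sat E rho A vals t1 + sat E rho A vals t2)).
    by move=> E s _; do 2!case: sat.
  apply: (computes_bin (op := fun a b => 1 < a + b) (ok := fun _ _ _ => true)) => //.
  + exact: IH1.
  + by apply: IH2 => //; apply: SS.
  + exact: LF.
  + by move=> E a b ha _; apply: leq_trans (leq_b1 _) _; lia.
- move=> t1 IH1 t2 IH2 r ctx r0 hc /CT[g1 g2 g2'] /andP[c1 c2].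
  apply: (computes_ext (v := fun E rho A vals =>
     0 < sat E rho A vals t1 + sat E rho A vals t2)).
    by move=> E s _; do 2!case: sat.
  apply: (computes_bin (op := fun a b => 0 < a + b) (ok := fun _ _ _ => true)) => //.
  + exact: IH1.
  + by apply: IH2 => //; apply: SS.
  + exact: LF.
  + by move=> E a b ha _; apply: leq_trans (leq_b1 _) _; lia.
- move=> f IH r ctx r0 hc hf fc.
  apply: (computes_ext (v := fun E rho A vals => (sat E rho A vals f : nat) == 0)).
    by move=> E s _; rewrite eqb0.
  apply: (computes_un (op := fun _ a => a == 0)) => //; first exact: IH.
  by move=> E a; apply: leq_trans (leq_b1 _) _; lia.
- move=> f IH r ctx r0 hc hf fc.
  apply: (computes_ext (v := fun E rho A vals =>
     0 < #|[pred i : 'I_(sz E) | sat E rho A (val i :: vals) f]|)).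
    move=> E s _; congr nat_of_bool; apply/card_gt0P/existsP => -[i hi]; exists i => //.
  apply: (computes_un (op := fun _ a => 0 < a)) => //; first exact: CNT.
  by move=> E a; apply: leq_trans (leq_b1 _) _; lia.
- move=> f IH r ctx r0 hc hf fc.
  apply: (computes_ext (v := fun E rho A vals =>
     #|[pred i : 'I_(sz E) | sat E rho A (val i :: vals) f]| == sz E)).
    move=> E s _; congr nat_of_bool; apply/eqP/forallP => [h i|h].
      have /subset_cardP/(_ (subset_predT _))/(_ i) : #|[pred i : 'I_(sz E) | sat E (regs s) (arrs s) (val i :: map (regs s) ctx) f]| = #|'I_(sz E)|.
        by rewrite h card_ord.
      by rewrite !inE.
    by rewrite -[RHS]card_ord; apply: eq_card => i; rewrite inE h.
  apply: (computes_un (op := fun E a => a == sz E)) => //; first exact: CNT.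
  + by move=> E s [h _ _]; rewrite /= h.
  + by move=> E a; apply: leq_trans (leq_b1 _) _; lia.
Qed.

(** * Searching all tuples for the smallest valid labelling *)

Definition tsmall (t : term) : bool :=
  match t with
  | TConst k => k <= 3
  | TArr _ _ | TIn _ _ | TLab _ _ => true
  | _ => false
  end.

Lemma den_small E s vals t : wfs E s -> tsmall t ->
  den E (regs s) (arrs s) vals t <= 3.
Proof.
move=> [_ _ ha]; case: t => //= [v w _|f g _].
  exact: leq_trans (mat_le2 _ _ _) _.
by do 2!case: sat.
Qed.

(* Register 5 runs over the vertices; it is the free variable [BV 0] of [t]. *)
Definition fill (a : nat) (t : term) : prog :=
  For 5 0 (Seq (tcode 12 [:: 5] t) (Write a (Reg 5) (Reg 12))).

(** The term must keep its meaning while the loop runs, so it may read neither the counter as [GV 5]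
    nor the array being overwritten. [tsmall] makes each written value a legal array entry. *)
Definition fill_ok (a : nat) (t : term) : bool :=
  [&& tsmall t, tconst t, all (fun x => (x < 12) && (x != 5)) (tglob t)
    & a \notin tarrs t].

Lemma triple_fill a t : fill_ok a t ->
  triple (tdepth t).+1 (fill a t) (fun _ _ => True)
    (fun E s s' => [/\ forall y, y < 12 -> y != 5 -> regs s' y = regs s y,
       forall b, b != a -> arrs s' b = arrs s b
     & forall i : 'I_(sz E), arrs s' a i = den E (regs s) (arrs s) [:: val i] t]).
Proof.
case/and4P => sm tc /allP tg ta.
have c := code_computes.1 t 12 [:: 5] isT isT
  (introT allP (fun x h => proj1 (andP (tg x h)))) tc.
have w := triple_write a (e1 := Reg 5) (e2 := Reg 12) isT isT.
have b : triple (tdepth t) (Seq (tcode 12 [:: 5] t) (Write a (Reg 5) (Reg 12)))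
   (fun _ _ => True)
   (fun E s s' => (forall y, y < 12 -> regs s' y = regs s y) /\
      arrs s' = fun b j => if (b == a) && (j == regs s 5)
        then den E (regs s) (arrs s) [:: regs s 5] t else arrs s b j).
  apply: triple_seq c (triple_conseq w (leq0n _) _) _.
    by move=> E s hs h; split; [exact: h|move=> s' _ h'; exact: h'].
  move=> E s s1 hs _ hs1 [k1 k2 k3]; split=> /=; first by rewrite k3 den_small.
  by move=> s2 hs2 ->; rewrite /= k1 // k2 k3; split.
pose Inv (E : env) (s0 : state) (i : nat) (s : state) :=
  [/\ forall y, y < 12 -> y != 5 -> regs s y = regs s0 y,
      forall b, b != a -> arrs s b = arrs s0 b
    & forall j, j < i -> arrs s a j = den E (regs s0) (arrs s0) [:: j] t].
apply: (@triple_conseq _ _ (fun _ _ => True) (fun E s s' => Inv E s (regs s 0) s')).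
- apply: triple_for b _ _ => //.
    by move=> E s hs _; split=> //= y y12 y5; rewrite (negbTE y5).
  move=> E s0 i s hs0 _ hs [i1 i2 i3] sx iN sy; split=> // s' hs' [q1 q2].
  split; rewrite ?q1 //; split=> /=.
  + by move=> y y12 y5; rewrite (negbTE y5) q1 // i1.
  + move=> b' ba; rewrite -i2 // q2; apply: functional_extensionality => j.
    by rewrite (negbTE ba).
  + move=> j; rewrite ltnS leq_eqVlt q2 eqxx sx /=; case: (eqVneq j i) => /= [-> _|_ /i3 //].
    apply: (den_sat_ext _ _ _ _ _).1 => x hx.
      by case/andP: (tg x hx) => ? ?; apply: i1.
    by apply: i2; apply: contraNneq ta => <-.
- by [].
- move=> E s [hs0 _ _] _; split=> // s' _ [j1 j2 j3]; split=> // i.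
  by apply: j3; rewrite hs0.
Qed.

(** * Nested loops over all tuples *)

Definition nest (xs : seq nat) (y : nat) (p : prog) : prog :=
  foldr (fun x q => For x y q) p xs.

Section Nest.
Variables (k y : nat) (p : prog) (xs : seq nat).
Variables (J : pre) (R : post) (G : env -> seq nat -> state -> Prop).
Hypothesis xs0 : 0 \notin xs.
Hypothesis xsy : y \notin xs.
Hypothesis xsu : uniq xs.
Hypothesis J_reg : forall E s x v, x \in xs -> J E s -> J E (set_reg s x v).
Hypothesis R_reg : forall E s x v, x \in xs -> R E s (set_reg s x v).
Hypothesis R_refl : forall E s, R E s s.
Hypothesis R_trans : forall E s1 s2 s3, R E s1 s2 -> R E s2 s3 -> R E s1 s3.
Hypothesis G_mono : forall E t s s', R E s s' -> G E t s -> G E t s'.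
Hypothesis body : triple k p J
  (fun E s s' => [/\ J E s', R E s s', forall x, x \in y :: xs -> regs s' x = regs s x
     & G E (map (regs s) xs) s']).

(** Induction on the inner loops: the counters in [pref] are fixed and those in [suff] run. What the
    body establishes for one tuple is [G]; it survives all later rounds because these only move
    along the preorder [R]. *)
Lemma triple_nest_suffix pref suff : xs = pref ++ suff ->
  triple (k + size suff) (nest suff y p) J
  (fun E s s' => [/\ J E s', R E s s',
     forall x, x \in y :: pref -> regs s' x = regs s x
     & forall t, size t = size suff -> all (fun v => v < regs s y) t ->
         G E (map (regs s) pref ++ t) s']).
Proof.
elim: suff pref => [|x suff IH] pref exs.
  rewrite addn0; apply: triple_conseq body _ _ => // E s hs hJ; split=> //.
  move=> s' _ [j1 j2 j3 j4]; rewrite cats0 in exs; rewrite -exs; split=> // -[|//] _ _.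
  by rewrite cats0.
have exs' : xs = rcons pref x ++ suff by rewrite cat_rcons.
have xin : x \in xs by rewrite exs mem_cat mem_head orbT.
have xnp : x \notin pref.
  by move: xsu; rewrite exs cat_uniq /= negb_or => /and3P[_ /andP[]].
have xy : x != y by apply: contraNneq xsy => <-.
have x0 : x != 0 by apply: contraNneq xs0 => <-.
rewrite /= addnS.
pose Inv (E : env) (s0 : state) (i : nat) (s : state) :=
  [/\ J E s, R E s0 s,
     forall x, x \in y :: pref -> regs s x = regs s0 x
     & forall t, size t = (size suff).+1 -> all (fun v => v < regs s0 y) t ->
         head 0 t < i -> G E (map (regs s0) pref ++ t) s].
apply: (@triple_conseq _ _ J (fun E s s' => Inv E s (regs s y) s')).
- apply: triple_for (IH _ exs') _ _ => //.
    move=> E s hs hJ; split=> //; [exact: J_reg|exact: R_reg|].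
    move=> z zin /=; case: eqP => // zx; move: zin; rewrite zx inE (negbTE xy).
    by rewrite (negbTE xnp).
  move=> E s0 i s hs0 _ hs [i1 i2 i3 i4] sx iN sy; split=> // s' hs' [q1 q2 q3 q4].
  split.
  + by rewrite q3 // inE mem_rcons mem_head orbT.
  + by rewrite q3 // mem_head.
  + have R' : R E s' (set_reg s' x i.+1) by apply: R_reg.
    split.
    * exact: J_reg.
    * exact: R_trans i2 (R_trans q2 R').
    * move=> z zin /=; have -> : (z == x) = false.
        apply/eqP => zx; move: zin; rewrite zx inE (negbTE xy).
        by rewrite (negbTE xnp).
      rewrite q3 ?i3 //; move: zin; rewrite !inE mem_rcons inE.
      by case/orP => ->; rewrite ?orbT.
    * case=> [//|v t] /= [st] /andP[vN tN]; rewrite ltnS leq_eqVlt.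
      case/orP => [/eqP vi|vi].
        apply: G_mono R' _; have := q4 t st; rewrite sy => /(_ tN).
        rewrite map_rcons sx vi -cat_rcons; congr (G E (rcons _ _ ++ _) _).
        by apply/eq_in_map => z zp; rewrite i3 // inE zp orbT.
      by apply: G_mono R' (G_mono q2 (i4 _ _ _ _)) => //=; rewrite ?st // vN.
- by [].
- move=> E s hs hJ; split=> // s' _ [j1 j2 j3 j4]; split=> // t st tN.
  by apply: j4 => //; case: t st tN => //= v t _ /andP[].
Qed.

Lemma triple_nest :
  triple (k + size xs) (nest xs y p) J
  (fun E s s' => J E s' /\
     forall t, size t = size xs -> all (fun v => v < regs s y) t -> G E t s').
Proof.
apply: triple_conseq (triple_nest_suffix (erefl : xs = [::] ++ xs)) _ _ => //.
by move=> E s _ hJ; split=> // s' _ [j1 _ _ j4]; split.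
Qed.
End Nest.

(** * Keeping the smallest valid candidate *)

Definition labelling (E : env) := 'I_(sz E) -> nat.
Definition lab (E : env) (s : state) : labelling E := fun i => arrs s 1 i.
Arguments lab : clear implicits.
Definition labelled (E : env) (L : labelling E) (i : 'I_(sz E)) : bool :=
  (L i == 1) || (L i == 2).
Definition lsize (E : env) (L : labelling E) : nat :=
  #|[pred i | labelled L i]|.

Definition flabelled (v : var) : formula :=
  FOr (FEq (TArr 1 v) (TConst 1)) (FEq (TArr 1 v) (TConst 2)).
Definition tcard : term := TCount (flabelled (BV 0)).

Definition keeps (s s' : state) : Prop :=
  forall y, y < 12 -> y != 4 -> y != 5 -> regs s' y = regs s y.

(** Register layout: 0 holds n, 1 the kind of answer, 2 the number [2n], 3 the smallest size so far,
    4 and 5 are counters of [build] and [fill], 6 to 11 hold the tuple, and scratch space starts at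
    12. The candidate is in array 1, the recorded answer in array 0. *)
Definition phase (kind : nat) (xs : seq nat) (y : nat) (build : prog)
    (valid : formula) (out : term) : prog :=
  nest xs y
    (Seq build
      (Seq (fcode 12 [::] (FAnd valid (FLt tcard (TVar (GV 3)))))
        (If (Reg 12)
           (Seq (tcode 12 [::] tcard)
             (Seq (Assign 3 (Reg 12))
                (Seq (Assign 1 (Const kind)) (fill 0 out))))
           Skip))).

Section Phase.
Variables (kind : nat) (xs : seq nat) (y : nat) (build : prog).
Variables (valid : formula) (out : term) (k : nat).
Variables (cand : forall E, seq nat -> labelling E).
Variables (V : forall E, labelling E -> bool) (outf : nat -> nat).
Arguments cand : clear implicits.
Hypothesis kind_le : kind <= 8.
Hypothesis xs_ok : all (fun x => 5 < x < 12) xs.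
Hypothesis xs_uniq : uniq xs.
Hypothesis y_ok : (y == 0) || (y == 2).
Hypothesis buildP : triple k build (fun _ _ => True)
  (fun E s s' => [/\ keeps s s', arrs s' 0 = arrs s 0
     & lab E s' = cand E (map (regs s) xs)]).
Hypothesis valid_ok : [&& all (fun x => x < 12) (fglob valid), fconst valid,
  fdepth valid <= k & 1 <= k].
Hypothesis validP : forall E rho A,
  sat E rho A [::] valid = V (fun i : 'I_(sz E) => A 1 i).
Hypothesis out_ok : fill_ok 0 out && (tdepth out < k).
Hypothesis outP : forall E rho A (i : 'I_(sz E)),
  den E rho A [:: val i] out = outf (A 1 i).

(** As long as nothing is recorded, register 3 holds [n + 1], which exceeds the size of every
    labelling; the first valid candidate therefore passes the size comparison. *)
Definition best (E : env) (s : state) : Prop :=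
  regs s 2 = (sz E).*2 /\
  ((regs s 1 = 0 /\ regs s 3 = (sz E).+1) \/
   (regs s 1 = kind /\ exists L : labelling E,
      [/\ V L, regs s 3 = lsize L & forall i : 'I_(sz E), arrs s 0 i = outf (L i)])).

Lemma lsize_le E (L : labelling E) : lsize L <= sz E.
Proof. by rewrite -[leqRHS]card_ord max_card. Qed.

Lemma triple_record :
  triple k (Seq (tcode 12 [::] tcard)
             (Seq (Assign 3 (Reg 12))
                (Seq (Assign 1 (Const kind)) (fill 0 out))))
    (fun _ _ => True)
    (fun E s s' => [/\ forall z, z < 12 -> z != 1 -> z != 3 -> z != 5 -> regs s' z = regs s z,
       regs s' 1 = kind, regs s' 3 = lsize (lab E s)
     & forall i : 'I_(sz E), arrs s' 0 i = outf (arrs s 1 i)]).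
Proof.
have /and4P[_ _ _ k1] := valid_ok; have /andP[oo ok] := out_ok.
have h1 := triple_conseq (code_computes.1 tcard 12 [::] isT isT isT isT) k1
  (fun E s hs h => conj h (fun s' _ h' => h')).
have h2 := triple_conseq (triple_assign (x := 3) (e := Reg 12) isT isT) (leq0n k)
  (fun E s hs (_ : True) => conj (let: And3 _ h _ := hs in h 12) (fun s' _ h' => h')).
have sk : esafe (Const kind) by rewrite /= andbT; apply: leq_ltn_trans kind_le _.
have h3 := triple_conseq (triple_assign (x := 1) (e := Const kind) isT sk) (leq0n k)
  (fun E s hs (_ : True) => conj (leq_trans kind_le (leq_addl _ _)) (fun s' _ h' => h')).
have h4 := triple_conseq (triple_fill oo) ok
  (fun E s hs h => conj h (fun s' _ h' => h')).
have h34 : triple k (Seq (Assign 1 (Const kind)) (fill 0 out)) (fun _ _ => True)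
  (fun E s s' => [/\ forall z, z < 12 -> z != 1 -> z != 5 -> regs s' z = regs s z,
       regs s' 1 = kind
     & forall i : 'I_(sz E), arrs s' 0 i = outf (arrs s 1 i)]).
  apply: triple_seq h3 h4 _ => E s s1 hs _ hs1 ->; split=> // s2 hs2 [q1 q2 q3]; split.
  - by move=> z z12 z1 z5; rewrite q1 //= (negbTE z1).
  - by rewrite q1.
  - by move=> i; rewrite q3 outP.
have h24 : triple k (Seq (Assign 3 (Reg 12)) (Seq (Assign 1 (Const kind)) (fill 0 out)))
  (fun _ _ => True)
  (fun E s s' =>
  [/\ forall z, z < 12 -> z != 1 -> z != 3 -> z != 5 -> regs s' z = regs s z,
       regs s' 1 = kind, regs s' 3 = regs s 12
     & forall i : 'I_(sz E), arrs s' 0 i = outf (arrs s 1 i)]).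
  apply: triple_seq h2 h34 _ => E s s1 hs _ hs1 ->; split=> // s2 hs2 [r1 r2 r3]; split=> //.
  - by move=> z z12 z1 z3 z5; rewrite r1 //= (negbTE z3).
  - by rewrite r1.
apply: triple_seq h1 h24 _ => E s s1 hs _ hs1 [q1 q2 q3].
split=> // s2 hs2 [r1 r2 r3 r4]; split=> //.
- by move=> z z12 z1 z3 z5; rewrite r1 // q1.
- by rewrite r3 q3.
- by move=> i; rewrite r4 q2.
Qed.

(** Register 3 never increases, so once it is at most the size of the candidate of a tuple, it
    remains so until the end. *)
Lemma triple_phase :
  triple (k + size xs) (phase kind xs y build valid out) best
    (fun E s s' => best E s' /\
       forall t, size t = size xs -> all (fun v => v < regs s y) t ->
         V (cand E t) -> regs s' 3 <= lsize (cand E t)).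
Proof.
have /and4P[vg vc vd k1] := valid_ok.
have xsP x : x \in xs -> 5 < x < 12 by move/allP: xs_ok; apply.
have notin z : z <= 5 -> z \notin xs.
  by move=> z5; apply/negP => /xsP /andP[]; lia.
apply: (triple_nest (R := fun E s s' => regs s' 3 <= regs s 3)
  (G := fun E t s => V (cand E t) -> regs s 3 <= lsize (cand E t))) => //.
- exact: notin.
- by case/orP: y_ok => /eqP ->; apply: notin.
- move=> E s x v /xsP /andP[x5 _] [b2 b13].
  have ne z : z <= 5 -> (z == x) = false by move=> z5; apply/eqP; lia.
  by rewrite /best /= !ne.
- move=> E s x v /xsP /andP[x5 _] /=.
  by have -> : (3 == x) = false by apply/eqP; lia.
- by move=> E s1 s2 s3 h1 h2; apply: leq_trans h2 h1.
- by move=> E t s s' h1 h2 /h2; apply: leq_trans.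
pose QI E s s' :=
  [/\ best E s', regs s' 3 <= regs s 3,
     forall z, z < 12 -> z != 1 -> z != 3 -> z != 4 -> z != 5 -> regs s' z = regs s z
   & V (lab E s) -> regs s' 3 <= lsize (lab E s)].
pose guard := FAnd valid (FLt tcard (TVar (GV 3))).
have hg := code_computes.2 guard 12 [::] isT isT.
have {}hg : computes 12 [::] k (fcode 12 [::] guard)
    (fun E rho A vals => sat E rho A vals guard).
  apply: triple_conseq (hg _ _) _ (fun E s hs h => conj h (fun s' _ h' => h')).
  - by rewrite /= all_cat vg.
  - by rewrite /= vc.
  - by rewrite /= maxn0 geq_max vd.
have hif : triple k (If (Reg 12)
           (Seq (tcode 12 [::] tcard)
             (Seq (Assign 3 (Reg 12))
                (Seq (Assign 1 (Const kind)) (fill 0 out))))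
           Skip)
   (fun E s => best E s /\ regs s 12 = V (lab E s) && (lsize (lab E s) < regs s 3)) QI.
  apply: triple_if => //.
    apply: triple_conseq triple_record _ _ => // E s hs /= [[[b2 b13] ->]].
    rewrite eqb0 negbK => /andP[hV lt]; split=> // s' hs' [q1 q2 q3 q4]; split.
    - split; first by rewrite q1.
      by right; split=> //; exists (lab E s); split.
    - by rewrite q3 ltnW.
    - by move=> z *; apply: q1.
    - by rewrite q3.
  apply: triple_conseq triple_skip _ _ => // E s hs /= [[bb ->]].
  move/eqP; rewrite eqb0 negb_and => nV; split=> // s' hs' ->; split=> // hV.
  by move: nV; rewrite hV /= -leqNgt.
have hgi : triple k (Seq (fcode 12 [::] guard) (If (Reg 12)
           (Seq (tcode 12 [::] tcard)
             (Seq (Assign 3 (Reg 12))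
                (Seq (Assign 1 (Const kind)) (fill 0 out))))
           Skip)) best QI.
  have hg' := triple_conseq (P' := best) hg (leqnn k)
    (fun E s hs _ => conj I (fun s' _ h' => h')).
  apply: triple_seq hg' hif _ => E s s1 hs bs hs1 [q1 q2 q3].
  have lq : lab E s1 = lab E s by rewrite /lab q2.
  split.
    split; first by rewrite /best !q1 // q2.
    by rewrite lq q3 q1 //= validP.
  move=> s2 hs2 [r1 r2 r3 r4]; split=> //.
  - by rewrite -(q1 3).
  - by move=> z z12 *; rewrite r3 // q1.
  - by rewrite -lq.
have hb := triple_conseq (P' := best) buildP (leqnn k)
    (fun E s hs _ => conj I (fun s' _ h' => h')).
apply: triple_seq hb hgi _ => E s s1 hs bs hs1 [q1 q2 q3].
split; first by rewrite /best !q1 // q2.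
move=> s2 hs2 [r1 r2 r3 r4]; split=> //.
- by rewrite -(q1 3).
- move=> z zin; have /and5P[z12 z1 z3 z4 z5] : [&& z < 12, z != 1, z != 3, z != 4 & z != 5].
    move: zin; rewrite inE => /orP[/eqP ->|/xsP]; last by lia.
    by case/orP: y_ok => /eqP ->.
  by rewrite r3 // q1.
- by rewrite -q3.
Qed.
End Phase.

(** * Labellings encoding homogeneous pairs and homogeneous sets *)

Definition adjb (E : env) (u v : nat) : bool := mat E u v == 2.
Definition antib (E : env) (u v : nat) : bool := (mat E u v == 0) && ~~ (u == v).

Definition fadj (u v : var) : formula := FEq (TIn u v) (TConst 2).
Definition fanti (u v : var) : formula :=
  FAnd (FEq (TIn u v) (TConst 0)) (FNot (FEq (TVar u) (TVar v))).

Section Labellings.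
Variable E : env.
Notation n := (sz E).
Notation T := (tg E).
Implicit Types (L g : labelling E) (w i a b : 'I_n).

Definition cpl L (l : nat) w := [forall a : 'I_n, ~~ (L a == l) || adjb E w a].
Definition acpl L (l : nat) w := [forall a : 'I_n, ~~ (L a == l) || antib E w a].
Definition good L w := (cpl L 1 w || acpl L 1 w) && (cpl L 2 w || acpl L 2 w).
Definition lclosed L := [forall w, labelled L w || good L w].

Definition pair_valid L :=
  lclosed L &&
  ([exists a, [exists b, (L a == 1) && ((L b == 2) && ~~ adjb E a b)]] &&
  ([exists a, [exists b, (L a == 1) && ((L b == 2) && ~~ antib E a b)]] &&
  ((2 < lsize L) && (2 < #|[pred i | ~~ labelled L i]|)))).

Definition small_valid L := pair_valid L && (lsize L < 7).

Definition set_valid L :=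
  [forall w, labelled L w ||
     ([forall a, ~~ labelled L a || adjb E w a] ||
      [forall a, ~~ labelled L a || antib E w a])] &&
  ((1 < lsize L) && (0 < #|[pred i | ~~ labelled L i]|)).

Definition proper_valid L :=
  pair_valid L &&
  ([exists c, ~~ labelled L c && (cpl L 1 c && acpl L 2 c)] &&
   [exists d, ~~ labelled L d && (acpl L 1 d && cpl L 2 d)]).

Definition cut_valid L := set_valid L || proper_valid L.

Definition lset L (l : nat) : {set 'I_n} := [set i | L i == l].
Definition lsupp L : {set 'I_n} := [set i | labelled L i].

Lemma adjP a b : adjb E a b = strongly_adjacent T a b.
Proof. exact: mat_adj. Qed.

Lemma antiP a b : antib E a b = strongly_antiadjacent T a b.
Proof. exact: mat_anti. Qed.

Lemma adj_sym a b : adjb E a b = adjb E b a.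
Proof. by rewrite !adjP /strongly_adjacent eq_sym setUC. Qed.

Lemma anti_sym a b : antib E a b = antib E b a.
Proof. by rewrite !antiP /strongly_antiadjacent eq_sym setUC. Qed.

Lemma adj_anti (u v : nat) : adjb E u v -> antib E u v -> False.
Proof. by rewrite /adjb /antib => /eqP ->. Qed.

Lemma adj_irr a : adjb E a a = false.
Proof. by rewrite adjP /strongly_adjacent eqxx. Qed.

Lemma anti_irr a : antib E a a = false.
Proof. by rewrite antiP /strongly_antiadjacent eqxx. Qed.

Lemma lsizeE L : lsize L = #|lsupp L|.
Proof. by apply: eq_card => i; rewrite !inE. Qed.

Lemma unlabelledE L : #|[pred i | ~~ labelled L i]| = #|~: lsupp L|.
Proof. by apply: eq_card => i; rewrite !inE. Qed.

Lemma lsuppE L : lsupp L = lset L 1 :|: lset L 2.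
Proof. by apply/setP => i; rewrite !inE. Qed.

Lemma cplP L l w : reflect (forall a, L a = l -> adjb E w a) (cpl L l w).
Proof.
apply: (iffP forallP) => h a; last by case: eqP => //= e; exact: h.
by move=> e; have := h a; rewrite e eqxx.
Qed.

Lemma acplP L l w : reflect (forall a, L a = l -> antib E w a) (acpl L l w).
Proof.
apply: (iffP forallP) => h a; last by case: eqP => //= e; exact: h.
by move=> e; have := h a; rewrite e eqxx.
Qed.

Lemma complete_lset L l (C : {set 'I_n}) :
  (forall w, w \in C -> cpl L l w) -> strongly_complete T (lset L l) C.
Proof.
move=> h; apply/forall_inP => a; rewrite inE => /eqP aa.
have H w : w \in C -> adjb E w a by move/h/cplP; apply.
apply/andP; split; last by apply/forall_inP => w /H; rewrite adj_sym adjP.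
by apply/negP => /H; rewrite adj_irr.
Qed.

Lemma anticomplete_lset L l (C : {set 'I_n}) :
  (forall w, w \in C -> acpl L l w) -> strongly_anticomplete T (lset L l) C.
Proof.
move=> h; apply/forall_inP => a; rewrite inE => /eqP aa.
have H w : w \in C -> antib E w a by move/h/acplP; apply.
apply/andP; split; last by apply/forall_inP => w /H; rewrite anti_sym antiP.
by apply/negP => /H; rewrite anti_irr.
Qed.

Lemma disjoint_cpl_acpl L l (C D : {set 'I_n}) : lset L l != set0 ->
  (forall w, w \in C -> cpl L l w) -> (forall w, w \in D -> acpl L l w) ->
  [disjoint C & D].
Proof.
case/set0Pn => a; rewrite inE => /eqP aa hC hD.
rewrite -setI_eq0; apply/eqP/setP => w; rewrite !inE.
apply/negP => /andP[/hC/cplP/(_ _ aa) h1 /hD/acplP/(_ _ aa)]; exact: adj_anti h1.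
Qed.

Definition part L (p q : labelling E -> nat -> 'I_n -> bool) : {set 'I_n} :=
  [set w | ~~ labelled L w && (p L 1 w && q L 2 w)].

(** The parts are sorted by the relation of a vertex to each side. They are disjoint because two
    different parts demand opposite relations to one of the sides, and both sides are nonempty; they
    cover the complement because the labelling is closed. *)
Lemma pair_valid_split L : pair_valid L ->
  homogeneous_pair_split T (lset L 1) (lset L 2)
    (part L cpl acpl) (part L acpl cpl) (part L cpl cpl) (part L acpl acpl).
Proof.
case/and5P => /forallP cl /existsP[a /existsP[b /and3P[a1 b2 nadj]]].
move=> /existsP[a' /existsP[b' /and3P[a1' b2' nanti]]] sz1 sz2.
have n1 : lset L 1 != set0 by apply/set0Pn; exists a; rewrite inE.
have n2 : lset L 2 != set0 by apply/set0Pn; exists b; rewrite inE.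
have in1 p q w : w \in part L p q -> p L 1 w by rewrite inE => /and3P[].
have in2 p q w : w \in part L p q -> q L 2 w by rewrite inE => /and3P[].
have cov : part L cpl acpl :|: part L acpl cpl :|: part L cpl cpl :|: part L acpl acpl
    = ~: (lset L 1 :|: lset L 2).
  rewrite -lsuppE; apply/setP => w; rewrite !inE; have := cl w.
  case: (labelled L w) => //= /andP[].
  by case: (cpl L 1 w); case: (acpl L 1 w); case: (cpl L 2 w); case: (acpl L 2 w).
split.
- split=> //; rewrite -setI_eq0; apply/eqP/setP => i; rewrite !inE.
  by case: eqP => // ->.
- split=> //; do 5?[apply/andP; split].
  + by apply: (disjoint_cpl_acpl n1) => w; [apply: in1|apply: in1].
  + by rewrite disjoint_sym; apply: (disjoint_cpl_acpl n2) => w; [apply: in2|apply: in2].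
  + by apply: (disjoint_cpl_acpl n1) => w; [apply: in1|apply: in1].
  + by rewrite disjoint_sym; apply: (disjoint_cpl_acpl n1) => w; [apply: in1|apply: in1].
  + by apply: (disjoint_cpl_acpl n2) => w; [apply: in2|apply: in2].
  + by apply: (disjoint_cpl_acpl n1) => w; [apply: in1|apply: in1].
- split.
  + by apply: complete_lset => w /setUP[] /in1.
  + by apply: anticomplete_lset => w /setUP[] /in1.
  + by apply: complete_lset => w /setUP[] /in2.
  + by apply: anticomplete_lset => w /setUP[] /in2.
- split; apply/negP => /forall_inP.
    move/(_ a); rewrite inE a1 => /(_ isT) /andP[_ /forall_inP/(_ b)].
    by rewrite inE b2 -adjP (negbTE nadj) => /(_ isT).
  move/(_ a'); rewrite inE a1' => /(_ isT) /andP[_ /forall_inP/(_ b')].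
  by rewrite inE b2' -antiP (negbTE nanti) => /(_ isT).
- by rewrite cov -lsuppE -lsizeE -unlabelledE.
Qed.

Lemma not_completeP (A B : {set 'I_n}) : [disjoint A & B] ->
  ~~ strongly_complete T A B -> exists a b, [/\ a \in A, b \in B & ~~ adjb E a b].
Proof.
move=> dis /forall_inPn[a aA]; rewrite negb_and negbK.
rewrite (disjointFr dis aA) /= => /forall_inPn[b bB nab].
by exists a, b; rewrite adjP.
Qed.

Lemma not_anticompleteP (A B : {set 'I_n}) : [disjoint A & B] ->
  ~~ strongly_anticomplete T A B -> exists a b, [/\ a \in A, b \in B & ~~ antib E a b].
Proof.
move=> dis /forall_inPn[a aA]; rewrite negb_and negbK.
rewrite (disjointFr dis aA) /= => /forall_inPn[b bB nab].
by exists a, b; rewrite antiP.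
Qed.

Definition pair_lab (A B : {set 'I_n}) : labelling E :=
  fun i => if i \in A then 1 else if i \in B then 2 else 0.

Lemma pair_lab1 (A B : {set 'I_n}) : lset (pair_lab A B) 1 = A.
Proof. by apply/setP => i; rewrite inE /pair_lab; case: (i \in A) => //; case: (i \in B). Qed.

Lemma pair_lab2 (A B : {set 'I_n}) : [disjoint A & B] -> lset (pair_lab A B) 2 = B.
Proof.
move=> dis; apply/setP => i; rewrite inE /pair_lab.
by case: ifP => [/(disjointFr dis) ->|_] //; case: ifP.
Qed.

Lemma strongly_completeP (A B : {set 'I_n}) a b :
  strongly_complete T A B -> a \in A -> b \in B -> adjb E b a.
Proof. by move=> /forall_inP h /h /andP[_ /forall_inP k] /k; rewrite adj_sym adjP. Qed.

Lemma strongly_anticompleteP (A B : {set 'I_n}) a b :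
  strongly_anticomplete T A B -> a \in A -> b \in B -> antib E b a.
Proof. by move=> /forall_inP h /h /andP[_ /forall_inP k] /k; rewrite anti_sym antiP. Qed.

Lemma pair_lab_closed (A B C D F G : {set 'I_n}) :
  homogeneous_pair_split T A B C D F G -> lclosed (pair_lab A B).
Proof.
case=> [[dis _ _] [_ cov] [h1 h2 h3 h4] _ _].
have e1 a : pair_lab A B a = 1 -> a \in A.
  by move=> h; rewrite -(pair_lab1 A B) inE h.
have e2 a : pair_lab A B a = 2 -> a \in B.
  by move=> h; rewrite -(pair_lab2 dis) inE h.
apply/forallP => w; case: (boolP (labelled _ w)) => //= nl.
have : w \in ~: (A :|: B).
  move: nl; rewrite !inE /labelled /pair_lab; case: ifP => //= _; by case: ifP.
rewrite -cov => /setUP[/setUP[/setUP[]|]|] wi; apply/andP; split; apply/orP.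
- by left; apply/cplP => a /e1 aA; apply: strongly_completeP h1 aA _; rewrite inE wi.
- by right; apply/acplP => a /e2 aA; apply: strongly_anticompleteP h4 aA _; rewrite inE wi.
- by right; apply/acplP => a /e1 aA; apply: strongly_anticompleteP h2 aA _; rewrite inE wi.
- by left; apply/cplP => a /e2 aA; apply: strongly_completeP h3 aA _; rewrite inE wi.
- by left; apply/cplP => a /e1 aA; apply: strongly_completeP h1 aA _; rewrite inE wi orbT.
- by left; apply/cplP => a /e2 aA; apply: strongly_completeP h3 aA _; rewrite inE wi orbT.
- by right; apply/acplP => a /e1 aA; apply: strongly_anticompleteP h2 aA _; rewrite inE wi orbT.
- by right; apply/acplP => a /e2 aA; apply: strongly_anticompleteP h4 aA _; rewrite inE wi orbT.
Qed.

Lemma lsupp_pair_lab (A B : {set 'I_n}) : lsupp (pair_lab A B) = A :|: B.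
Proof.
apply/setP => i; rewrite !inE /labelled /pair_lab.
by case: (i \in A) => //=; case: (i \in B).
Qed.

Lemma small_pair_valid (A B : {set 'I_n}) :
  small_homogeneous_pair T A B -> small_valid (pair_lab A B).
Proof.
case=> [[C [D [F [G h]]]] s6]; have cl := pair_lab_closed h.
case: h => [[dis _ _] [_ cov] _ [nc nac] [s3 r3]].
apply/andP; split; last by rewrite lsizeE lsupp_pair_lab.
apply/and5P; split=> //.
- have [a [b [aA bB nab]]] := not_completeP dis nc.
  apply/existsP; exists a; apply/existsP; exists b; rewrite nab andbT.
  by rewrite /pair_lab aA bB /= (disjointFl dis bB).
- have [a [b [aA bB nab]]] := not_anticompleteP dis nac.
  apply/existsP; exists a; apply/existsP; exists b; rewrite nab andbT.
  by rewrite /pair_lab aA bB /= (disjointFl dis bB).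
- by rewrite lsizeE lsupp_pair_lab.
- by rewrite unlabelledE lsupp_pair_lab -cov.
Qed.

Lemma small_valid_pair L : small_valid L ->
  small_homogeneous_pair T (lset L 1) (lset L 2).
Proof.
case/andP => /pair_valid_split h s; split; first by do 4!eexists; exact: h.
by rewrite -lsuppE -lsizeE.
Qed.

Lemma cut_valid_cut L : cut_valid L -> homogeneous_cut T (lsupp L) (~: lsupp L).
Proof.
move=> h; split; first by rewrite setUCr.
  by rewrite -setI_eq0 setICr.
case/orP: h => [/and3P[/forallP h s1 s0]|/and3P[/pair_valid_split h hc hd]].
  left; split.
    by rewrite -(cardsC (lsupp L)) -lsizeE -unlabelledE; lia.
  move=> v vn; have := h v; rewrite inE in vn; rewrite (negbTE vn) /=.
  case/orP => /forallP hv; [left|right]; apply/andP; split; rewrite ?inE //;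
    apply/forall_inP => a; rewrite inE => la; have := hv a;
    by rewrite la /= ?adjP ?antiP.
right; exists (lset L 1), (lset L 2); split; first exact: lsuppE.
do 4!eexists; split; first exact: h.
  by case/existsP: hc => c hc; apply/set0Pn; exists c; rewrite inE.
by case/existsP: hd => d hd; apply/set0Pn; exists d; rewrite inE.
Qed.

End Labellings.

(** * Closure of a seed under forced labels *)

Section Closure.
Variable E : env.
Notation n := (sz E).
Notation T := (tg E).
Implicit Types (L g : labelling E) (w i a b : 'I_n).

(* For [c != d] these are the sides of the only proper pair candidates with
   [c] in the part C and [d] in the part D of the split; [c = d] selects the
   search for homogeneous sets, where every vertex may get label 1. *)
Definition side1 (c d w : nat) : bool := (c == d) || (adjb E c w && antib E d w).
Definition side2 (c d w : nat) : bool := antib E c w && adjb E d w.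

Definition seed (c d x y z : nat) : labelling E := fun i =>
  let sel := (val i == x) || ((val i == y) || (val i == z)) in
  (sel && side1 c d i) + (sel && side2 c d i).*2.

Definition bad L i := ~~ labelled L i && ~~ good L i.

(** A bad vertex that belongs to neither side stays unlabelled. Since labels are never removed, it
    stays bad, so the candidate fails the final test. *)
Definition step (c d : nat) L : labelling E := fun i =>
  ((L i == 1) || (bad L i && side1 c d i)) +
  ((L i == 2) || (bad L i && side2 c d i)).*2.

Definition below L g := forall i, L i != 0 -> L i = g i.

(** * Growth of the closure inside a closed target labelling *)

Section Target.
Variables (c d : nat) (g : labelling E).
Hypothesis g_le2 : forall i, g i <= 2.
Hypothesis g_side : forall i, g i != 0 -> side1 c d i + (side2 c d i).*2 = g i.
Hypothesis g_closed : lclosed g.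

Lemma below_labelled L i : below L g -> labelled L i = (L i != 0).
Proof.
move=> /(_ i); have := g_le2 i; rewrite /labelled.
by case: (L i) => [|[|[|m]]] // h /(_ isT) e; move: h; rewrite -e.
Qed.

(** Goodness quantifies over the members of each label class, and the classes of [L] are contained
    in those of [g]. *)
Lemma good_below L w : below L g -> good g w -> good L w.
Proof.
move=> Lg /andP[h1 h2].
have M l : 0 < l -> cpl g l w || acpl g l w -> cpl L l w || acpl L l w.
  move=> l0 /orP[/cplP h|/acplP h]; apply/orP; [left; apply/cplP|right; apply/acplP];
  by move=> a e; apply: h; rewrite -Lg e // -lt0n.
by apply/andP; split; apply: M.
Qed.

(** This keeps the closure inside the target: a vertex outside the target is good for it, since the
    target is closed, hence good for every labelling below it. *)
Lemma bad_target L w : below L g -> bad L w -> g w != 0.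
Proof.
move=> Lg /andP[_ ng]; apply: contraNneq ng => gw; apply: good_below => //.
by have /forallP/(_ w) := g_closed; rewrite /labelled gw.
Qed.

Lemma stepE L : below L g ->
  forall i, step c d L i = if bad L i then g i else L i.
Proof.
move=> Lg i; rewrite /step; case: ifP => [bi|nb] /=.
  have gi := bad_target Lg bi; move: (bi); rewrite /bad below_labelled // negbK.
  by case/andP => /eqP -> _; rewrite -g_side.
have := Lg i; have := g_le2 i; rewrite !orbF.
by case: (L i) => [|[|[|m]]] // h /(_ isT) e; move: h; rewrite -e.
Qed.

Lemma step_below L : below L g -> below (step c d L) g.
Proof. by move=> Lg i; rewrite stepE //; case: ifP => // _; exact: Lg. Qed.

Lemma below_step L : below L g -> forall i, L i != 0 -> step c d L i = L i.
Proof.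
by move=> Lg i Li; rewrite stepE // /bad below_labelled // Li.
Qed.

Lemma lsupp_step L : below L g -> lsupp L \subset lsupp (step c d L).
Proof.
move=> Lg; apply/subsetP => i; rewrite !inE !below_labelled //; last exact: step_below.
by move=> Li; rewrite below_step.
Qed.

Lemma lsize_step L : below L g -> ~~ lclosed L -> lsize L < lsize (step c d L).
Proof.
move=> Lg /forallPn[w]; rewrite negb_or => bw; rewrite !lsizeE.
apply/proper_card/properP; split; first exact: lsupp_step.
have Lg' := step_below Lg; exists w; rewrite inE.
  by rewrite below_labelled // stepE // /bad bw (bad_target Lg).
by case/andP: bw.
Qed.

Lemma step_closed L : below L g -> lclosed L -> step c d L = L.
Proof.
move=> Lg /forallP cl; apply: functional_extensionality => i; rewrite stepE //.
by have := cl i; rewrite /bad -negb_or => ->.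
Qed.

Lemma closure_spec L : below L g -> 0 < lsize L ->
  let L' := iter n (step c d) L in
  [/\ below L' g, lclosed L' & forall i, L i != 0 -> L' i = L i].
Proof.
move=> Lg L0.
(* Each round that does not end in a closed labelling adds a vertex. After n such rounds a nonempty
   seed would have grown beyond n vertices. *)
have H m : let L' := iter m (step c d) L in
    [/\ below L' g, lclosed L' \/ m + lsize L <= lsize L'
      & forall i, L i != 0 -> L' i = L i].
  elim: m => [|m [b1 b2 b3]] /=; first by split=> //; right.
  split; first exact: step_below.
    case: (boolP (lclosed (iter m (step c d) L))) => [cl|ncl].
      by left; rewrite step_closed.
    right; case: b2 => [h|h]; first by rewrite h in ncl.
    by apply: leq_ltn_trans h (lsize_step b1 ncl).
  by move=> i Li; rewrite below_step // b3.
have [b1 b2 b3] := H n; split=> //; case: b2 => // h.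
by have := lsize_le (iter n (step c d) L); lia.
Qed.

End Target.

Definition closure_lab (t : seq nat) : labelling E :=
  let c := nth 0 t 0 in let d := nth 0 t 1 in
  iter n (step c d) (seed c d (nth 0 t 2) (nth 0 t 3) (nth 0 t 4)).

Lemma seed_target c d x y z g :
  (forall i, g i != 0 -> side1 c d i + (side2 c d i).*2 = g i) ->
  g x != 0 -> g y != 0 -> g z != 0 ->
  below (seed c d x y z) g /\
  forall i, i \in [:: x; y; z] -> seed c d x y z i = g i.
Proof.
move=> gs gx gy gz.
have S i : seed c d x y z i = if i \in [:: x; y; z] then g i else 0.
  rewrite /seed !inE !(inj_eq val_inj); case: ifP => [h|] //=.
  by rewrite gs //; case/or3P: h => /eqP ->.
by split=> [i|i h]; rewrite S ?h //; case: ifP.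
Qed.

Lemma lsupp_below L g : (forall i, g i <= 2) -> below L g ->
  lsupp L \subset [set i | g i != 0].
Proof.
move=> g2 Lg; apply/subsetP => i; rewrite !inE (below_labelled g2) // => Li.
by rewrite -Lg.
Qed.

Lemma closure_target (c d x y z : 'I_n) g :
  (forall i, g i <= 2) ->
  (forall i, g i != 0 -> side1 c d i + (side2 c d i).*2 = g i) -> lclosed g ->
  g x != 0 -> g y != 0 -> g z != 0 ->
  let L := closure_lab [:: val c; val d; val x; val y; val z] in
  [/\ below L g, lclosed L & forall i, i \in [:: x; y; z] -> L i = g i].
Proof.
move=> g2 gs gc gx gy gz; have [s1 s2] := seed_target gs gx gy gz.
have [|b1 b2 b3] := closure_spec g2 gs gc s1.
  rewrite lsizeE; apply/card_gt0P; exists x.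
  by rewrite inE (below_labelled g2) // s2 ?mem_head.
split=> // i hi; rewrite -s2 // -b3 // s2 //.
by move: hi; rewrite !inE => /or3P[] /eqP ->.
Qed.

(** * Every homogeneous set, proper pair and small pair is matched by a tuple *)

Lemma homogeneous_set_found (X : {set 'I_n}) : homogeneous_set T X ->
  exists t, [/\ size t = 5, all (fun v => v < n) t, cut_valid (closure_lab t)
    & lsize (closure_lab t) <= #|X|].
Proof.
case=> /andP[X1 Xn] hX.
have /card_gt1P[x [y [xX yX xy]]] := X1.
pose g : labelling E := fun i => i \in X.
have g2 i : g i <= 2 by rewrite /g; case: (i \in X).
have gX i : i \in X -> g i != 0 by rewrite /g => ->.
have Xg i : g i != 0 -> i \in X by rewrite /g; case: (i \in X).
have gs i : g i != 0 -> side1 x x i + (side2 x x i).*2 = g i.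
  rewrite /g /side1 eqxx /= => /Xg ->.
  suff -> : side2 x x i = false by [].
  by apply/negP => /andP[h1 h2]; apply: adj_anti h2 h1.
have gc : lclosed g.
  apply/forallP => w; rewrite /labelled /g; case: (boolP (w \in X)) => //= wX.
  apply/andP; split; last by apply/orP; left; apply/cplP => a; case: (a \in X).
  apply/orP; case: (hX w wX) => /andP[_ /forall_inP h]; [left; apply/cplP|right; apply/acplP];
    by move=> a /eqP; rewrite eqb1 => /h; rewrite ?adjP ?antiP.
have [b1 b2 b3] := closure_target g2 gs gc (gX _ xX) (gX _ yX) (gX _ yX).
have sub := lsupp_below g2 b1.
have gXE : [set i | g i != 0] = X.
  by apply/setP => i; rewrite inE; apply/idP/idP => [/Xg|/gX].
rewrite gXE in sub.
(* The equal first entries select the search for homogeneous sets, for which any vertex would do;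
   the seeds are [x] and [y], with [y] repeated to fill the third place. *)
exists [:: val x; val x; val x; val y; val y].
set L := closure_lab _ in b1 b2 b3 sub *.
have L1 i : labelled L i = (L i == 1).
  rewrite (below_labelled g2) //; apply/idP/eqP => [h|-> //].
  by have e := b1 i h; move: h; rewrite e => /Xg; rewrite /g => ->.
split=> //; first by rewrite /= !ltn_ord.
  apply/orP; left; apply/and3P; split.
  - apply/forallP => w; have /forallP/(_ w) := b2; case: (labelled L w) => //= /andP[h _].
    case/orP: h => /forallP h; apply/orP; [left|right]; apply/forallP => a; rewrite L1; exact: h.
  - rewrite lsizeE; apply/card_gt1P; exists x, y.
    by rewrite !inE !(below_labelled g2) // !b3 ?inE ?eqxx ?orbT // !gX.
  - rewrite unlabelledE cardsCs setCK card_ord subn_gt0.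
    by rewrite card_ord in Xn; apply: leq_ltn_trans (subset_leq_card sub) Xn.
by rewrite lsizeE subset_leq_card.
Qed.

(* Among the pairs of A x B, one not strongly adjacent and one not strongly
   antiadjacent can be chosen to share a vertex, so three seeds suffice. *)
Lemma pair_seeds (A B : {set 'I_n}) : [disjoint A & B] ->
  ~~ strongly_complete T A B -> ~~ strongly_anticomplete T A B ->
  3 <= #|A :|: B| ->
  exists s : seq 'I_n, [/\ size s = 3, uniq s, {subset s <= A :|: B},
    exists a b, [/\ a \in A, b \in B, a \in s, b \in s & ~~ adjb E a b]
    & exists a b, [/\ a \in A, b \in B, a \in s, b \in s & ~~ antib E a b]].
Proof.
move=> dis nc nac s3.
have nAB a b : a \in A -> b \in B -> a != b.
  by move=> aA bB; apply: contraTneq bB => <-; rewrite (disjointFr dis aA).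
have third (u v : 'I_n) : exists w, [/\ w \in A :|: B, w != u & w != v].
  have /set0Pn[w] : (A :|: B) :\: [set u; v] != set0.
    rewrite -card_gt0 cardsD subn_gt0; apply: leq_trans s3.
    by rewrite ltnS; apply: leq_trans (subset_leq_card (subsetIr _ _)) _; rewrite cards2; case: eqP.
  rewrite !inE negb_or => /andP[/andP[wu wv] h]; exists w; split=> //.
  by rewrite inE.
have [a1 [b1 [a1A b1B n1]]] := not_completeP dis nc.
have [a2 [b2 [a2A b2B n2]]] := not_anticompleteP dis nac.
(* If one pair witnesses both failures, any further vertex of [A :|: B] completes the triple. *)
have two a b : a \in A -> b \in B -> ~~ adjb E a b -> ~~ antib E a b ->
   exists s : seq 'I_n, [/\ size s = 3, uniq s, {subset s <= A :|: B},
    exists a b, [/\ a \in A, b \in B, a \in s, b \in s & ~~ adjb E a b]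
    & exists a b, [/\ a \in A, b \in B, a \in s, b \in s & ~~ antib E a b]].
  move=> aA bB nab1 nab2; have [w [wAB wa wb]] := third a b.
  exists [:: w; a; b]; split=> //.
  - by rewrite /= !inE negb_or wa wb nAB.
  - by move=> i; rewrite !inE => /or3P[] /eqP ->; rewrite ?aA ?bB ?orbT //; rewrite inE in wAB.
  - by exists a, b; rewrite !inE !eqxx !orbT.
  - by exists a, b; rewrite !inE !eqxx !orbT.
(* The mixed pair [a1], [b2] can replace one of the two witnesses: if strongly adjacent, it is not
   strongly antiadjacent and shares [a1] with the first; otherwise it is not strongly adjacent and
   shares [b2] with the second. *)
case: (boolP (adjb E a1 b2)) => [h|n12].
  have n12 : ~~ antib E a1 b2 by apply/negP; apply: adj_anti h.
  have [e|ne] := eqVneq b1 b2; first by rewrite e in n1; apply: (two a1 b2).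
  exists [:: a1; b1; b2]; split=> //.
  - by rewrite /= !inE negb_or ne !nAB.
  - by move=> i; rewrite !inE => /or3P[] /eqP ->; rewrite ?a1A ?b1B ?b2B ?orbT.
  - by exists a1, b1; rewrite !inE !eqxx !orbT.
  - by exists a1, b2; rewrite !inE !eqxx !orbT.
have [e|ne] := eqVneq a1 a2; first by rewrite e in n12; apply: (two a2 b2).
exists [:: a1; a2; b2]; split=> //.
- by rewrite /= !inE negb_or ne !nAB.
- by move=> i; rewrite !inE => /or3P[] /eqP ->; rewrite ?a1A ?a2A ?b2B ?orbT.
- by exists a1, b2; rewrite !inE !eqxx !orbT.
- by exists a2, b2; rewrite !inE !eqxx !orbT.
Qed.

(** The closure inherits every condition of a proper pair: the witnessing pairs and three vertices
    are among the seeds, the complement only grows, and [c] and [d] remain outside with the same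
    relations to the smaller sides. *)
Lemma proper_pair_found (A B : {set 'I_n}) : proper_homogeneous_pair T A B ->
  exists t, [/\ size t = 5, all (fun v => v < n) t, cut_valid (closure_lab t)
    & lsize (closure_lab t) <= #|A :|: B|].
Proof.
case=> C [D [F [G [h /set0Pn[c cC] /set0Pn[d dD]]]]].
pose g := pair_lab A B; have gc : lclosed g := pair_lab_closed h.
case: h => [[dis _ _] [_ cov] [h1 h2 h3 h4] [nc nac] [s3 r3]].
have [s [ss su sAB [a [b [aA bB as_ bs nab]]] [a' [b' [aA' bB' as' bs' nab']]]]] :=
  pair_seeds dis nc nac s3.
case: s ss su sAB as_ bs as' bs' => [|x [|y [|z [|//]]]] // _ su sAB as_ bs as' bs'.
have g1 i : i \in A -> g i = 1 by rewrite /g /pair_lab => ->.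
have gB i : i \in B -> g i = 2.
  by move=> iB; rewrite /g /pair_lab (disjointFl dis iB) iB.
have g2 i : g i <= 2 by rewrite /g /pair_lab; do 2?case: ifP.
have gAB i : (g i != 0) = (i \in A :|: B).
  by rewrite inE /g /pair_lab; case: (i \in A) => //; case: (i \in B).
have cA i : i \in A -> adjb E c i.
  by move=> iA; apply: strongly_completeP h1 iA _; rewrite inE cC.
have cB i : i \in B -> antib E c i.
  by move=> iB; apply: strongly_anticompleteP h4 iB _; rewrite inE cC.
have dA i : i \in A -> antib E d i.
  by move=> iA; apply: strongly_anticompleteP h2 iA _; rewrite inE dD.
have dB i : i \in B -> adjb E d i.
  by move=> iB; apply: strongly_completeP h3 iB _; rewrite inE dD.
(* Distinctness keeps [side1] out of its homogeneous-set mode. *)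
have cd : (val c == val d) = false.
  by apply/eqP => cd; apply: (adj_anti (cA _ aA)); rewrite cd; apply: dA.
have gs i : g i != 0 -> side1 c d i + (side2 c d i).*2 = g i.
  rewrite gAB /side1 /side2 cd /= => /setUP[iA|iB].
    rewrite cA // dA // g1 //; case: (boolP (antib E c i)) => //= /(adj_anti (cA _ iA)) [].
  rewrite cB // dB // gB //; case: (boolP (adjb E c i)) => //= k.
  by case: (adj_anti k (cB _ iB)).
have [||| b1 b2 b3] := closure_target g2 gs gc (x := x) (y := y) (z := z).
- by rewrite gAB sAB // mem_head.
- by rewrite gAB sAB // !inE eqxx orbT.
- by rewrite gAB sAB // !inE eqxx !orbT.
have sub := lsupp_below g2 b1.
have gABE : [set i | g i != 0] = A :|: B by apply/setP => i; rewrite inE gAB.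
rewrite gABE in sub.
exists [:: val c; val d; val x; val y; val z].
set L := closure_lab _ in b1 b2 b3 sub *.
have L1 i : L i = 1 -> i \in A.
  move=> Li; have /b1 : L i != 0 by rewrite Li.
  by rewrite Li /g /pair_lab; case: (i \in A) => //; case: (i \in B).
have L2 i : L i = 2 -> i \in B.
  move=> Li; have /b1 : L i != 0 by rewrite Li.
  by rewrite Li /g /pair_lab; case: (i \in A) => //; case: (i \in B).
have out i : i \notin A :|: B -> ~~ labelled L i.
  by apply: contra => li; apply: (subsetP sub); rewrite inE.
have out' i : i \in ~: (A :|: B) -> ~~ labelled L i by rewrite in_setC; apply: out.
rewrite -cov in out'.
split=> //; first by rewrite /= !ltn_ord.
  apply/orP; right; apply/and3P; split.
  - apply/and5P; split=> //.
    + apply/existsP; exists a; apply/existsP; exists b.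
      by rewrite nab !b3 // g1 // gB.
    + apply/existsP; exists a'; apply/existsP; exists b'.
      by rewrite nab' !b3 // g1 // gB.
    + rewrite lsizeE; have <- : size [:: x; y; z] = 3 by [].
      rewrite -(card_uniqP su); apply/subset_leq_card/subsetP => i hi.
      by rewrite inE (below_labelled g2) // b3 // gAB sAB.
    + rewrite unlabelledE; apply: leq_trans r3 _; rewrite cov.
      by rewrite subset_leq_card // setCS.
  - apply/existsP; exists c; rewrite out' ?inE ?cC //=; apply/andP; split.
      by apply/cplP => i /L1 /cA.
    by apply/acplP => i /L2 /cB.
  - apply/existsP; exists d; rewrite out' ?inE ?dD ?orbT //=; apply/andP; split.
      by apply/acplP => i /L1 /dA.
    by apply/cplP => i /L2 /dB.
by rewrite lsizeE subset_leq_card.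
Qed.

(** An entry [v < n] puts the vertex [v] on the first side, and an entry [n + v] puts it on the
    second. A vertex named on both sides gets 3 and so counts as unlabelled. *)
Definition tuple_lab (t : seq nat) : labelling E := fun i =>
  (val i \in t) + (n + val i \in t).*2.

Lemma small_pair_found (A B : {set 'I_n}) : small_homogeneous_pair T A B ->
  exists t, [/\ size t = 6, all (fun v => v < n.*2) t & tuple_lab t = pair_lab A B].
Proof.
move=> h; have [[C [D [F [G [[dis A0 _] _ _ _ _]]]]] s6] := h.
have [a aA] := set0Pn _ A0.
pose u := [seq val i | i <- enum A] ++ [seq n + val i | i <- enum B].
have su : size u <= 6.
  rewrite size_cat !size_map -!cardE; move: s6; rewrite cardsU disjoint_setI0 //.
  by rewrite cards0 subn0.
(* Pairs with fewer than six vertices are padded by repeating a vertex of [A], which does not change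
   the labelling. *)
pose t := u ++ nseq (6 - size u) (val a).
have mt v : (v \in t) = (v \in u).
  rewrite mem_cat mem_nseq orb_idr // => /andP[_ /eqP ->].
  by rewrite mem_cat map_f // mem_enum.
have uA (i : 'I_n) : (val i \in u) = (i \in A).
  rewrite mem_cat (mem_map val_inj) mem_enum orb_idr // => /mapP[j _ e].
  by have := ltn_ord i; rewrite e; lia.
have uB (i : 'I_n) : (n + val i \in u) = (i \in B).
  rewrite mem_cat (mem_map (f := fun j : 'I_n => n + val j)); last first.
    by move=> x y /addnI /val_inj.
  rewrite mem_enum; apply: orb_idl => /mapP[j _ e].
  by have := ltn_ord j; rewrite -[nat_of_ord j]e ltnNge leq_addr.
exists t; split.
- by rewrite size_cat size_nseq subnKC.
- apply/allP => v; rewrite mt mem_cat => /orP[] /mapP[i _ ->]; have /= := ltn_ord i; lia.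
- apply: functional_extensionality => i; rewrite /tuple_lab !mt uA uB /pair_lab.
  case: (boolP (i \in A)) => [iA|_]; first by rewrite (disjointFr dis iA).
  by case: (i \in B).
Qed.

End Closure.

(** * The program *)

Definition flab (l : nat) (v : var) : formula := FEq (TArr 1 v) (TConst l).
Definition fcpl (l : nat) : formula :=
  FAll (FOr (FNot (flab l (BV 0))) (fadj (BV 1) (BV 0))).
Definition facpl (l : nat) : formula :=
  FAll (FOr (FNot (flab l (BV 0))) (fanti (BV 1) (BV 0))).
Definition fgood : formula :=
  FAnd (FOr (fcpl 1) (facpl 1)) (FOr (fcpl 2) (facpl 2)).
Definition fout : formula := FNot (flabelled (BV 0)).

Definition fcross (f : formula) : formula :=
  FEx (FEx (FAnd (flab 1 (BV 1)) (FAnd (flab 2 (BV 0)) (FNot f)))).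

Definition fpair : formula :=
  FAnd (FAll (FOr (flabelled (BV 0)) fgood))
    (FAnd (fcross (fadj (BV 1) (BV 0)))
       (FAnd (fcross (fanti (BV 1) (BV 0)))
          (FAnd (FLt (TConst 2) tcard) (FLt (TConst 2) (TCount fout))))).

Definition fsmall : formula := FAnd fpair (FLt tcard (TConst 7)).

Definition fset : formula :=
  FAnd (FAll (FOr (flabelled (BV 0))
    (FOr (FAll (FOr fout (fadj (BV 1) (BV 0))))
         (FAll (FOr fout (fanti (BV 1) (BV 0)))))))
    (FAnd (FLt (TConst 1) tcard) (FLt (TConst 0) (TCount fout))).

Definition fproper : formula :=
  FAnd fpair
    (FAnd (FEx (FAnd fout (FAnd (fcpl 1) (facpl 2))))
       (FEx (FAnd fout (FAnd (facpl 1) (fcpl 2))))).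

Definition xs1 : seq nat := [:: 6; 7; 8; 9; 10; 11].

Definition fany (f : nat -> formula) : formula :=
  foldr (fun x h => FOr (f x) h) (FLt (TConst 0) (TConst 0)) xs1.

(** The term language has no addition, so [n + i = x] is tested as [i = x - n]; the guard [x >= n]
    excludes truncated subtraction. *)
Definition build1 : prog :=
  fill 1 (TLab (fany (fun x => FEq (TVar (BV 0)) (TVar (GV x))))
    (fany (fun x => FAnd (FNot (FLt (TVar (GV x)) (TVar (GV 0))))
                 (FEq (TVar (BV 0)) (TSub (TVar (GV x)) (TVar (GV 0))))))).

Definition phase1 : prog := phase 1 xs1 2 build1 fsmall (TArr 1 (BV 0)).

Lemma build1P : triple 2 build1 (fun _ _ => True)
  (fun E s s' => [/\ keeps s s', arrs s' 0 = arrs s 0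
     & lab E s' = @tuple_lab E (map (regs s) xs1)]).
Proof.
apply: triple_conseq (triple_fill (a := 1) _) _ _ => //.
move=> E s [h0 _ _] _; split=> // s' _ [q1 q2 q3]; split.
- by move=> y y12 _ y5; apply: q1.
- by rewrite q2.
apply: functional_extensionality => i; rewrite /lab q3 /tuple_lab /=; congr (_ + _).
have sub x : ~~ (regs s x < regs s 0) && (i == regs s x - regs s 0 :> nat) =
             (sz E + i == regs s x).
  by rewrite h0 /=; lia.
by rewrite !inE !sub ltnn orbF.
Qed.

Lemma phase1P :
  triple 8 phase1 (best 1 (@small_valid) id)
    (fun E s s' => best 1 (@small_valid) id E s' /\
       forall t, size t = 6 -> all (fun v => v < regs s 2) t ->
         small_valid (@tuple_lab E t) -> regs s' 3 <= lsize (@tuple_lab E t)).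
Proof. by apply: triple_phase build1P _ _ _ _. Qed.

Definition xs2 : seq nat := [:: 6; 7; 8; 9; 10].

Definition fside1 : formula :=
  FOr (FEq (TVar (GV 6)) (TVar (GV 7)))
    (FAnd (fadj (GV 6) (BV 0)) (fanti (GV 7) (BV 0))).
Definition fside2 : formula :=
  FAnd (fanti (GV 6) (BV 0)) (fadj (GV 7) (BV 0)).
Definition fsel : formula :=
  FOr (FEq (TVar (BV 0)) (TVar (GV 8)))
    (FOr (FEq (TVar (BV 0)) (TVar (GV 9))) (FEq (TVar (BV 0)) (TVar (GV 10)))).
Definition fbad : formula := FAnd fout (FNot fgood).

Definition tseed : term := TLab (FAnd fsel fside1) (FAnd fsel fside2).
Definition tstep : term :=
  TLab (FOr (flab 1 (BV 0)) (FAnd fbad fside1))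
       (FOr (flab 2 (BV 0)) (FAnd fbad fside2)).

(* Array 2 holds the new labels, so that a round updates all labels at once. *)
Definition round : prog := Seq (fill 2 tstep) (fill 1 (TArr 2 (BV 0))).
Definition build2 : prog := Seq (fill 1 tseed) (For 4 0 round).

(** A cut is reported as a bipartition, so both labels become 1 and all other vertices get 2. *)
Definition tcut : term := TLab (flabelled (BV 0)) (FNot (flabelled (BV 0))).
Definition cutf (l : nat) : nat :=
  ((l == 1) || (l == 2)) + (~~ ((l == 1) || (l == 2))).*2.

Definition phase2 : prog := phase 2 xs2 0 build2 (FOr fset fproper) tcut.

Lemma roundP : triple 2 round (fun _ _ => True)
  (fun E s s' => [/\ forall y, y < 12 -> y != 5 -> regs s' y = regs s y,
     arrs s' 0 = arrs s 0
   & lab E s' = step (regs s 6) (regs s 7) (lab E s)]).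
Proof.
have h1 := triple_fill (a := 2) (t := tstep) isT.
have h2 := triple_conseq (triple_fill (a := 1) (t := TArr 2 (BV 0)) isT) (leqnSn 1)
  (fun E s hs h => conj h (fun s' _ h' => h')).
apply: triple_seq h1 h2 _ => E s s1 hs _ hs1 [q1 q2 q3].
split=> // s2 hs2 [r1 r2 r3]; split.
- by move=> y y12 y5; rewrite r1 // q1.
- by rewrite r2 // q2.
- by apply: functional_extensionality => i; rewrite /lab r3 /= q3.
Qed.

Lemma build2P : triple 3 build2 (fun _ _ => True)
  (fun E s s' => [/\ keeps s s', arrs s' 0 = arrs s 0
     & lab E s' = @closure_lab E (map (regs s) xs2)]).
Proof.
have h1 := triple_conseq (triple_fill (a := 1) (t := tseed) isT) (isT : 1 <= 3)
  (fun E s hs h => conj h (fun s' _ h' => h')).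
pose Inv (E : env) (s0 : state) (i : nat) (s : state) :=
  [/\ keeps s0 s, arrs s 0 = arrs s0 0
    & lab E s = iter i (step (regs s0 6) (regs s0 7)) (lab E s0)].
have h2 : triple 3 (For 4 0 round) (fun _ _ => True)
    (fun E s s' => Inv E s (regs s 0) s').
  apply: triple_for roundP _ _ => //.
    by move=> E s hs _; split=> // y y12 y4 y5 /=; rewrite (negbTE y4).
  move=> E s0 i s hs0 _ hs [i1 i2 i3] sx iN sy; split=> // s' hs' [q1 q2 q3].
  split; rewrite ?q1 //; split.
  - by move=> y y12 y4 y5 /=; rewrite (negbTE y4) q1 // i1.
  - by rewrite /= q2.
  - by rewrite iterS -i3 -(i1 6) // -(i1 7) // -q3.
apply: triple_seq h1 h2 _ => E s s1 hs _ hs1 [q1 q2 q3].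
split=> // s2 hs2 [r1 r2 r3]; split.
- by move=> y y12 y4 y5; rewrite r1 // q1.
- by rewrite r2 q2.
have h0 : regs s1 0 = sz E by case: hs1.
rewrite r3 h0 !q1 // /closure_lab; congr (iter _ _ _).
by apply: functional_extensionality => i; rewrite /lab q3.
Qed.

Lemma phase2P :
  triple 8 phase2 (best 2 (@cut_valid) cutf)
    (fun E s s' => best 2 (@cut_valid) cutf E s' /\
       forall t, size t = 5 -> all (fun v => v < regs s 0) t ->
         cut_valid (@closure_lab E t) -> regs s' 3 <= lsize (@closure_lab E t)).
Proof. by apply: triple_phase build2P _ _ _ _. Qed.

(** * Combining the two searches *)

Definition main_tail : prog :=
  If (Binop Defs.Eq (Reg 1) (Const 0))
    (Seq phase2 (If (Binop Defs.Eq (Reg 1) (Const 0)) (Assign 1 (Const 3)) Skip))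
    Skip.

Definition main_prog : prog :=
  Seq (Assign 2 (Binop Defs.Add (Reg 0) (Reg 0)))
    (Seq (Assign 3 (Binop Defs.Add (Reg 0) (Const 1)))
       (Seq phase1 main_tail)).

Definition answered (E : env) (s : state) : Prop :=
  exists o : output 'I_(sz E),
    decode_output (sz E) s = Some o /\ correct_output (tg E) o.

Lemma answered_pair E s (L : labelling E) : regs s 1 = 1 -> small_valid L ->
  (forall i : 'I_(sz E), arrs s 0 i = L i) -> answered E s.
Proof.
move=> s1 vL sL; have sm := small_valid_pair vL.
exists (OutPair (lset L 1) (lset L 2)); split.
  rewrite /decode_output s1; congr (Some (OutPair _ _));
  by apply/setP => i; rewrite !inE sL.
have hs : has_small_homogeneous_pair (tg E) by do 2!eexists; exact: sm.
by split=> // _; do 2!eexists; split; first reflexivity.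
Qed.

Lemma homogeneous_cut_found E (X Y : {set 'I_(sz E)}) :
  homogeneous_cut (tg E) X Y ->
  exists t, [/\ size t = 5, all (fun v => v < sz E) t,
    cut_valid (@closure_lab E t) & lsize (@closure_lab E t) <= #|X|].
Proof.
case=> _ _ [|[A [B [-> /proper_pair_found //]]]].
exact: homogeneous_set_found.
Qed.

(** A cut with a properly smaller side would be matched by a valid closure with fewer vertices than
    [L], against the minimality of [lsize L] among all closures. *)
Lemma answered_cut E s (L : labelling E) :
  ~ has_small_homogeneous_pair (tg E) -> regs s 1 = 2 -> cut_valid L ->
  (forall i : 'I_(sz E), arrs s 0 i = cutf (L i)) ->
  (forall t, size t = 5 -> all (fun v => v < sz E) t ->
     cut_valid (@closure_lab E t) -> lsize L <= lsize (@closure_lab E t)) ->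
  answered E s.
Proof.
move=> ns s1 vL sL minL; have cut := cut_valid_cut vL.
exists (OutCut (lsupp L) (~: lsupp L)); split.
  rewrite /decode_output s1; congr (Some (OutCut _ _)); apply/setP => i;
  by rewrite !inE sL /cutf /labelled; case: (_ || _).
split=> //; last by move=> _ []; do 2!eexists; exact: cut.
move=> _ _; do 2!eexists; split; first reflexivity.
split=> // -[X [Y [/homogeneous_cut_found[t [t5 tn vt le]] /proper_card]]].
by rewrite -lsizeE ltnNge (leq_trans (minL t t5 tn vt)).
Qed.

Lemma answered_none E s :
  ~ has_small_homogeneous_pair (tg E) -> ~ has_homogeneous_cut (tg E) ->
  regs s 1 = 3 -> answered E s.
Proof.
move=> ns nc s1; exists (OutNone _); split; first by rewrite /decode_output s1.
have cut (X : {set 'I_(sz E)}) : homogeneous_set (tg E) X \/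
    (exists A B, X = A :|: B /\ proper_homogeneous_pair (tg E) A B) -> False.
  move=> h; apply: nc; exists X, (~: X); split=> //; first exact: setUCr.
  by rewrite -setI_eq0 setICr.
split=> // _ _; split=> //; split=> //.
- by case=> A [B h]; apply: (cut (A :|: B)); right; exists A, B.
- by case=> X h; apply: (cut X); left.
Qed.

Lemma main_tailP : triple 8 main_tail
  (fun E s => best 1 (@small_valid) id E s /\
     (regs s 1 = 0 -> ~ has_small_homogeneous_pair (tg E)))
  (fun E s s' => answered E s').
Proof.
apply: triple_if => //; last first.
  apply: triple_conseq triple_skip _ _ => // E s hs [[[b2 b13] ns] /= s1].
  split=> // s' _ ->; case: b13 => [[e _]|[e [L [vL _ sL]]]].
    by rewrite e in s1.
  exact: answered_pair vL sL.
have h3 : triple 8 (If (Binop Defs.Eq (Reg 1) (Const 0)) (Assign 1 (Const 3)) Skip)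
    (fun _ _ => True)
    (fun E s s' => s' = if regs s 1 == 0 then set_reg s 1 3 else s).
  apply: triple_if => //.
    apply: triple_conseq (triple_assign (x := 1) (e := Const 3) _ _) _ _ => //.
    move=> E s hs [_ /=]; rewrite eqb0 negbK => s1; split; first by lia.
    by move=> s' _ ->; rewrite s1.
  apply: triple_conseq triple_skip _ _ => // E s hs [_ /=] /eqP.
  by rewrite eqb0 => /negbTE s1; split=> // s' _ ->; rewrite s1.
have h2 : triple 8 phase2
    (fun E s => best 2 (@cut_valid) cutf E s /\ ~ has_small_homogeneous_pair (tg E))
    (fun E s s' => [/\ best 2 (@cut_valid) cutf E s',
       ~ has_small_homogeneous_pair (tg E)
     & forall t, size t = 5 -> all (fun v => v < sz E) t ->
         cut_valid (@closure_lab E t) -> regs s' 3 <= lsize (@closure_lab E t)]).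
  apply: triple_conseq phase2P _ _ => // E s [h0 _ _] [b ns]; split=> //.
  by move=> s' _ [b' m]; split=> //; rewrite h0 in m.
have h23 : triple 8
    (Seq phase2 (If (Binop Defs.Eq (Reg 1) (Const 0)) (Assign 1 (Const 3)) Skip))
    (fun E s => best 2 (@cut_valid) cutf E s /\ ~ has_small_homogeneous_pair (tg E))
    (fun E s s' => answered E s').
  apply: triple_seq h2 h3 _ => E s s1 hs _ hs1 [[b2 b13] ns m].
  split=> // s2 _ ->; case: b13 => [[e e3]|[e [L [vL e3 sL]]]]; rewrite e /=.
    (* A cut would be matched by a valid tuple, forcing the sentinel [n + 1] in register 3 to be at
       most the size of a labelling, hence at most n. *)
    apply: answered_none => // -[X [Y /homogeneous_cut_found[t [t5 tn vt _]]]].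
    have := m t t5 tn vt; rewrite e3 ltnNge => /negP; apply.
    exact: lsize_le.
  by apply: answered_cut vL sL _ => // t t5 tn vt; rewrite -e3 m.
apply: triple_conseq h23 _ _ => // E s hs [[[b2 b13] ns] /=].
rewrite eqb0 negbK => /eqP s1; split; last by move=> s' _ h; exact: h.
split; last exact: ns.
(* Having recorded nothing, the first search leaves [n + 1] in register 3, so the second starts
   without resetting it. *)
by split=> //; left; case: b13 => [//|[e _]]; rewrite s1 in e.
Qed.

Lemma main_progP : triple 8 main_prog (fun E s => regs s 1 = 0)
  (fun E s s' => answered E s').
Proof.
have h3 : triple 8 (Seq phase1 main_tail) (best 1 (@small_valid) id)
    (fun E s s' => answered E s').
  apply: triple_seq phase1P main_tailP _ => E s s1 hs [b2 _] hs1 [b m].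
  split; last by move=> s2 _ h; exact: h.
  (* If no kind is recorded, register 3 is still [n + 1]; the tuple of a small pair would bound it
     by the size of a labelling. *)
  split=> // e [A [B sm]]; case: (b) => _ [[_ e3]|[e1]]; last by rewrite e in e1.
  have [t [t6 tn et]] := small_pair_found sm.
  have := m t t6; rewrite b2 et => /(_ tn (small_pair_valid sm)).
  by rewrite e3 ltnNge lsize_le.
have a e x (P : pre) : x != 0 -> esafe e ->
    (forall E s, wfs E s -> ev E s e <= (sz E).*2 + 8) ->
    triple 8 (Assign x e) P (fun E s s' => s' = set_reg s x (ev E s e)).
  move=> x0 he hb; apply: triple_conseq (triple_assign x0 he) _ _ => // E s hs _.
  by split=> //; apply: hb.
have h2 : triple 8 (Seq (Assign 3 (Binop Defs.Add (Reg 0) (Const 1))) (Seq phase1 main_tail))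
    (fun E s => regs s 2 = (sz E).*2 /\ regs s 1 = 0) (fun E s s' => answered E s').
  apply: triple_seq (a _ _ _ _ _ _) h3 _ => //.
    by move=> E s [h0 _ _] /=; rewrite h0; lia.
  move=> E s s1 [h0 _ _] [e2 e1] hs1 ->; split; last by move=> s2 _ h; exact: h.
  by split=> //=; left; rewrite h0 addn1.
apply: triple_seq (a _ _ _ _ _ _) h2 _ => //.
  by move=> E s [h0 _ _] /=; rewrite h0; lia.
move=> E s s1 [h0 _ _] e1 hs1 ->; split; last by move=> s2 _ h; exact: h.
by split=> //=; rewrite h0 addnn.
Qed.

Theorem theorem4p3 :
  exists (p : prog) (k c n0 : nat),
    forall (n : nat) (T : trigraph 'I_n),
      exists (t : nat) (s : state) (o : output 'I_n),
        [/\ exec (n.+2 ^ k) (input_matrix T) p (init_state n) t s,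
            decode_output n s = Some o,
            correct_output T o
          & n0 <= n -> t <= c * n ^ 8].
Proof.
(* The exponent 8 of the word bound is the one in [wbound]. The factor [2 ^ 8] and the threshold 1
   turn a bound in [n + 1] into one in [n], since [n + 1] is at most [2n] for positive n. *)
have [K H] := main_progP; exists main_prog, 8, (K * 2 ^ 8), 1 => n T.
have hs : wfs (Env T) (init_state n).
  by split=> //= x; case: ifP => _ //; lia.
have [t [s [ex tB [_ [o [ho co]]]]]] := H (Env T) (init_state n) hs erefl.
exists t, s, o; split=> // n1; apply: leq_trans tB _.
rewrite -mulnA leq_mul2l -expnMn leq_exp2r //=; lia.
Qed.
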